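(* Consider the nonstandard renewal risk model described in the context, let $q_1\in(0,1]$, $q_2\in[0,1]$ with $q_1\mu_G<q_2c\mu_H$, and let $$R_{01}(t)=q_1\sum_{i=1}^{N(t)}Y_i-q_2c\sum_{i=1}^{N(t)}Z_i,\qquad t\ge0.$$ Let $Y_i$, $i\ge1$, be ENOD random variables with common distribution $G\in\mathcal C$ and dominating coefficient $M_G$, let $Z_i$, $i\ge1$, be ENOD random variables with common distribution $H$ and dominating coefficient $M_H$, and suppose $\overline H(x)=o(\overline G(x))$ as $x\to\infty$. (i) In Case 1, for each $\gamma>q_1\mu_G$, $$\lim_{t\to\infty}\sup_{x\ge\gamma t}\left|\frac{P(R_{01}(t)>x)}{\mu_H^{-1}t\,\overline G\big(q_1^{-1}x-\mu_G\mu_H^{-1}t+q_2cq_1^{-1}t\big)}-1\right|=0.$$ (ii) In Case 2, for each pair $q_1\mu_G<\gamma<\Gamma<\infty$, $$\lim_{t\to\infty}\sup_{x\in[\gamma t,\Gamma t]}\left|\frac{P(R_{01}(t)>x)}{\mu_H^{-1}t\,\overline G\big(q_1^{-1}x-\mu_G\mu_H^{-1}t+q_2cq_1^{-1}t\big)}-1\right|=0.$$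
   Context: Notation: for a distribution $F$, $\overline F=1-F$ is its tail, and for $y\in(0,\infty)$, $\overline{F_*}(y)=\liminf_{x\to\infty}\overline F(xy)/\overline F(x)$. The class $\mathcal C$ (consistently varying tails) consists of the distributions $F$ with $\lim_{y\downarrow 1}\overline{F_*}(y)=1$. Dependence: random variables $X_i$, $i\ge1$, are ENOD (extended negatively orthant dependent) with dominating coefficient $M>0$ if for all $n\ge 1$ and all real $x_1,\dots,x_n$, both $P(\bigcap_{i=1}^n\{X_i>x_i\})\le M\prod_{i=1}^nP(X_i>x_i)$ and $P(\bigcap_{i=1}^n\{X_i\le x_i\})\le M\prod_{i=1}^nP(X_i\le x_i)$. Renewal risk model: claim sizes $Y_i$, $i\ge1$, are random variables with common distribution $G$ on $[0,\infty)$ and mean $0<\mu_G<\infty$; inter-arrival times $Z_i$, $i\ge1$, are random variables with common distribution $H$ on $[0,\infty)$ and mean $0<\mu_H<\infty$; $\tau$ is a nonnegative random variable (random time); $c$ is a positive constant. $N(t)=\sum_{n\ge1}\mathbf 1_{\{Z_1+\cdots+Z_n\le t\}}$, $\lambda(t)=EN(t)$, with $\inf\{t:0<\lambda(t)<\infty\}=0$. Empty sums equal $0$. $R_{01}$ is called the proportional net loss process. Case 1 of the nonstandard model: $\{Y_i,i\ge1\}$, $\{Z_i,i\ge1\}$ and $\tau$ are independent of each other, but at least one of $\{Y_i\}$ and $\{Z_i\}$ is a dependent sequence. Case 2 of the nonstandard model: $\{(Y_i,Z_i),i\ge1\}$ and $\tau$ are independent of each other, but the sequences $\{Y_i,i\ge1\}$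 and $\{Z_i,i\ge1\}$ are allowed to be arbitrarily dependent on each other. *)

(* Defs.v *)
From mathcomp Require Import all_boot all_order all_algebra.
From mathcomp Require Import all_classical all_reals all_analysis.

Set Implicit Arguments.
Unset Strict Implicit.
Unset Printing Implicit Defensive.

Import Order.TTheory GRing.Theory Num.Theory.
Import numFieldNormedType.Exports.

Local Open Scope classical_set_scope.
Local Open Scope ring_scope.

Definition Pr d (T : measurableType d) (R : realType) (P : probability T R)
  (A : set T) : R := fine (P A).

(** Distributions on the real line are Borel probability measures on [R]. *)

Definition has_distribution d (T : measurableType d) (R : realType)
    (P : probability T R) (X : {RV P >-> R})
    (F : probability (measurableTypeR R) R) : Prop :=
  forall A : set (measurableTypeR R), measurable A -> distribution P X A = F A.

Definition mean (R : realType) (F : probability (measurableTypeR R) R) : \bar R :=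
  (\int[F]_x x%:E)%E.

Definition tail (R : realType) (F : probability (measurableTypeR R) R) (x : R) : R :=
  1 - Pr F `]-oo, x].

Definition lower_tail_ratio (R : realType)
    (F : probability (measurableTypeR R) R) (y : R) : \bar R :=
  limf_einf (fun x : R => (tail F (x * y) / tail F x)%:E) +oo.

(** Since [a / 0 = 0], a tail that vanishes eventually has lower ratio [0] for
    every [y]; hence members of this class have an everywhere positive tail. *)
Definition consistently_varying (R : realType)
    (F : probability (measurableTypeR R) R) : Prop :=
  lower_tail_ratio F y @[y --> (1 : R)^'+] --> 1%E.

(** A sequence [X_1, X_2, ...] is represented by [X 0, X 1, ...]. *)
Definition ENOD d (T : measurableType d) (R : realType) (P : probability T R)
    (X : nat -> {RV P >-> R}) (M : R) : Prop :=
  0 < M /\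
  forall n : nat, (1 <= n)%N -> forall x : nat -> R,
    Pr P (\bigcap_(i in [set i | (i < n)%N]) [set w | X i w > x i])
      <= M * \prod_(i < n) Pr P [set w | X i w > x i] /\
    Pr P (\bigcap_(i in [set i | (i < n)%N]) [set w | X i w <= x i])
      <= M * \prod_(i < n) Pr P [set w | X i w <= x i].

Definition sigma_generated d d' (T : measurableType d) (T' : measurableType d')
    (I : Type) (X : I -> T -> T') : set (set T) :=
  <<s \bigcup_(i in [set: I]) preimage_set_system setT (X i) measurable >>.

(** Mutual independence of the classes of events [C i]. *)
Definition independent_classes d (T : measurableType d) (R : realType)
    (P : probability T R) (I : eqType) (C : I -> set (set T)) : Prop :=
  forall (J : seq I) (E : I -> set T), uniq J ->
    (forall i, i \in J -> C i (E i)) ->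
    Pr P (\bigcap_(i in [set` J]) E i) = \prod_(i <- J) Pr P (E i).

Definition independent_sequence d (T : measurableType d) (R : realType)
    (P : probability T R) (X : nat -> {RV P >-> R}) : Prop :=
  independent_classes P
    (fun i => sigma_generated (fun _ : unit => X i : T -> R)).

Definition case1 d (T : measurableType d) (R : realType) (P : probability T R)
    (Y Z : nat -> {RV P >-> R}) (tau : {RV P >-> R}) : Prop :=
  independent_classes P
    (tnth [tuple sigma_generated (fun i => Y i : T -> R);
                 sigma_generated (fun i => Z i : T -> R);
                 sigma_generated (fun _ : unit => tau : T -> R)]) /\
  ~ (independent_sequence Y /\ independent_sequence Z).

Definition case2 d (T : measurableType d) (R : realType) (P : probability T R)
    (Y Z : nat -> {RV P >-> R}) (tau : {RV P >-> R}) : Prop :=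
  independent_classes P
    (tnth [tuple sigma_generated (fun i (w : T) => (Y i w, Z i w));
                 sigma_generated (fun _ : unit => tau : T -> R)]).

Definition claim_number d (T : measurableType d) (R : realType)
    (P : probability T R) (Z : nat -> {RV P >-> R}) (t : R) (w : T) : \bar R :=
  (\sum_(1 <= n <oo) (\1_[set v | (\sum_(i < n) Z i v <= t)%R] w)%:E)%E.

Definition renewal_function d (T : measurableType d) (R : realType)
    (P : probability T R) (Z : nat -> {RV P >-> R}) (t : R) : \bar R :=
  (\int[P]_w claim_number Z t w)%E.

(** [claim_number] takes values in the natural numbers and [+oo];
    [claim_number_nat] is its value as a natural number, and [0] (that is, the
    random sums below are empty) where it is infinite: a null event as soon as
    [renewal_function Z t] is finite. *)
Definition claim_number_nat d (T : measurableType d) (R : realType)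
    (P : probability T R) (Z : nat -> {RV P >-> R}) (t : R) (w : T) : nat :=
  Num.truncn (fine (claim_number Z t w)).

Definition proportional_net_loss d (T : measurableType d) (R : realType)
    (P : probability T R) (Y Z : nat -> {RV P >-> R}) (q1 q2 c t : R) (w : T) : R :=
  q1 * (\sum_(i < claim_number_nat Z t w) Y i w)
  - q2 * c * (\sum_(i < claim_number_nat Z t w) Z i w).

(** The infimum is taken in [\bar R], so that it is [+oo] on the empty set. *)
Definition renewal_risk_model d (T : measurableType d) (R : realType)
    (P : probability T R) (Y Z : nat -> {RV P >-> R}) (tau : {RV P >-> R})
    (G H : probability (measurableTypeR R) R) (muG muH c : R) : Prop :=
  [/\ [/\ forall i, has_distribution (Y i) G, Pr G `[0, +oo[ = 1,
          mean G = muG%:E & 0 < muG],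
      [/\ forall i, has_distribution (Z i) H, Pr H `[0, +oo[ = 1,
          mean H = muH%:E & 0 < muH],
      {ae P, forall w, 0 <= tau w},
      0 < c &
      ereal_inf [set t%:E | t in
        [set t : R | (0 < renewal_function Z t < +oo)%E]] = 0%E].

Definition relative_error d (T : measurableType d) (R : realType)
    (P : probability T R) (Y Z : nat -> {RV P >-> R})
    (G : probability (measurableTypeR R) R) (muG muH q1 q2 c t x : R) : R :=
  `| Pr P [set w | proportional_net_loss Y Z q1 q2 c t w > x]
     / (muH^-1 * t * tail G (q1^-1 * x - muG * muH^-1 * t + q2 * c * q1^-1 * t))
     - 1 |.

(** [f = o(g)] at [+oo]: what [f =o_F g] unfolds to for [F := pinfty_nbhs R],
    which is not registered as a canonical [filter_on]. *)
Definition littleo_pinfty (R : realType) (f g : R -> R) : Prop :=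
  forall eps : R, 0 < eps -> \forall x \near +oo, `|f x| <= eps * `|g x|.

(* Main.v *)
Require Import Defs.
From mathcomp Require Import all_boot all_order all_algebra.
From mathcomp Require Import all_classical all_reals all_analysis.
From mathcomp Require Import measurable_realfun.
From mathcomp Require Import ring lra.

Set Implicit Arguments.
Unset Strict Implicit.
Unset Printing Implicit Defensive.

Import Order.TTheory GRing.Theory Num.Theory.
Import numFieldNormedType.Exports.

Local Open Scope classical_set_scope.
Local Open Scope ring_scope.

(** Heavy tails: the aggregate claim [S n] of [n] claims exceeds its mean by a
    large amount [x] essentially when a single claim does, so that
    [P (S n > n * muG + x)] is asymptotic to [n * tail G x], uniformly for [x] at
    least of order [n] ([large_deviation_le], [large_deviation_ge]). The number
    of claims up to [t] is close to [t / muH], and the inter-arrival times up to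
    the last claim sum up to nearly [t]. Substituting both into the net loss
    gives the level
    [y = x / q1 - muG * t / muH + q2 * c * t / q1] and the number [t / muH] of
    claims in the denominator; the loading condition makes [y] grow linearly
    in [t].

    The dependence enters only through orthant probabilities. Since a product
    of step functions of the variables is a combination of indicators of
    orthants, Chernoff bounds hold as for independent variables up to the
    factor [M] ([Pr_prod_step]). They give an exponential bound for the lower
    tail of sums of nonnegative variables ([lower_chernoff]) and a bound of
    order [(n * tail G (rho * x)) ^ 2] for sums truncated at [rho * x]
    ([truncated_chernoff]). Large deviations follow because two large claims
    are also of that order, while [x * tail G x] tends to zero.

    Consistent variation is used twice: it makes the tail insensitive to a
    small relative change of its argument, and it makes the tail decay at most
    polynomially ([potter]), so that exponentially small probabilities do not
    count.

    Deviations of the claim number are of three kinds. Too few claims by time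
    [t], or one long gap between claims, have probability [o (t * tail G t)],
    because the inter-arrival times have a lighter tail than the claims
    ([few_arrivals_negligible], [long_gap_negligible]); too many claims have
    exponentially small probability ([many_arrivals]). If [x <= Gamma * t], such
    events are negligible by themselves, whatever the dependence between
    claims and arrivals. If [x] is larger, independence contributes the missing
    factor [tail G x] ([rare_event], [late_claims]). *)

(** * Inequalities between probabilities of finitely many events *)

Lemma eq_ler (R : numDomainType) (x y : R) : x = y -> x <= y.
Proof. by move=> ->. Qed.

Lemma big_option_sum (R : nmodType) (I : finType) (F : option I -> R) :
  \sum_o F o = F None + \sum_i F (Some i).
Proof.
rewrite (bigD1 None)//=; congr (_ + _).
rewrite (reindex_omap Some id)/=; last by case.
by apply: eq_bigl => i; rewrite eqxx.
Qed.

Section finite_linear_inequalities.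
Context d (T : measurableType d) (R : realType) (P : probability T R).

Lemma Pr_ge0 (A : set T) : 0 <= Pr P A.
Proof. by rewrite fine_ge0. Qed.

Lemma Pr_le1 (A : set T) : measurable A -> Pr P A <= 1.
Proof.
by move=> mA; rewrite -lee_fin fineK ?fin_num_measure// probability_le1.
Qed.

Lemma Pr_eq0 (A : set T) : measurable A -> Pr P A = 0 -> P A = 0%E.
Proof. by move=> mA A0; rewrite -[LHS]fineK ?fin_num_measure//; congr EFin. Qed.

(** A linear inequality between indicators integrates to the same inequality
    between probabilities; the union bound, Bonferroni's inequality and
    Markov's inequality for step functions below are instances. Nothing is
    required on the null event [N], which serves to assume the variables
    nonnegative. *)
Lemma Pr_sum_ge0 (I : finType) (c : I -> R) (A : I -> set T) (N : set T) :
  (forall i, measurable (A i)) -> measurable N -> Pr P N = 0 ->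
  (forall w, ~ N w -> 0 <= \sum_i c i * \1_(A i) w) ->
  0 <= \sum_i c i * Pr P (A i).
Proof.
move=> mA mN N0 ge0.
(* on N the sum of indicators is at least - C, and adding C * 1_N costs nothing *)
pose C := \sum_i `|c i|.
have ge0' w : 0 <= C * \1_N w + \sum_i c i * \1_(A i) w.
  have [Nw|Nw] := pselect (N w); last first.
    by rewrite indicE (memNset Nw) mulr0 add0r; exact: ge0.
  rewrite indicE mem_set// mulr1 /C -big_split/=; apply: sumr_ge0 => i _.
  rewrite indicE; case: (w \in A i) => /=.
    by rewrite mulr1 -lerBlDr sub0r -normrN ler_norm.
  by rewrite mulr0 addr0.
have int c0 B : measurable B ->
    P.-integrable setT (fun w => (c0 * \1_B w)%:E).
  move=> mB; under eq_fun do rewrite EFinM.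
  by apply: integrableZl => //; exact: integrable_indic.
have intE c0 B : measurable B ->
    (\int[P]_w (c0 * \1_B w)%:E = (c0 * Pr P B)%:E)%E.
  move=> mB; under eq_integral do rewrite EFinM.
  rewrite integralZl//; last exact: integrable_indic.
  by rewrite integral_indic// setIT EFinM /Pr fineK// fin_num_measure.
have : (0 <= \int[P]_w (C * \1_N w + \sum_i c i * \1_(A i) w)%:E)%E.
  by apply: integral_ge0 => w _; rewrite lee_fin.
under eq_integral do rewrite EFinD -sumEFin.
rewrite integralD//; [|exact: int|by apply: integrable_sum => // i _; exact: int].
rewrite intE// integral_sum//; last by move=> i; exact: int.
under eq_bigr do rewrite intE//.
by rewrite N0 mulr0 add0e sumEFin lee_fin.
Qed.

Lemma Pr_le (N A B : set T) : measurable A -> measurable B ->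
  measurable N -> Pr P N = 0 ->
  (forall w, ~ N w -> A w -> B w) -> Pr P A <= Pr P B.
Proof.
move=> mA mB mN N0 AB.
have := @Pr_sum_ge0 bool (fun b => if b then 1 else -1)
  (fun b => if b then B else A) N.
rewrite !big_bool/= mul1r mulN1r subr_ge0; apply => //.
  by case.
move=> w Nw; rewrite big_bool/= !indicE mul1r mulN1r subr_ge0.
by have [/set_mem/(AB w Nw)/mem_set ->|] := boolP (w \in A).
Qed.

Lemma Pr_le_sum (I : finType) (N A : set T) (B : I -> set T) :
  measurable A -> (forall i, measurable (B i)) ->
  measurable N -> Pr P N = 0 ->
  (forall w, ~ N w -> A w -> exists i, B i w) ->
  Pr P A <= \sum_i Pr P (B i).
Proof.
move=> mA mB mN N0 AB.
have := @Pr_sum_ge0 (option I) (fun o => if o is Some _ then 1 else -1)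
  (fun o => if o is Some i then B i else A) N.
rewrite !big_option_sum mulN1r addrC subr_ge0.
under eq_bigr do rewrite mul1r.
apply => //; first by case.
move=> w Nw; rewrite big_option_sum mulN1r addrC subr_ge0 indicE.
under eq_bigr do rewrite mul1r.
have [/set_mem/(AB w Nw)[i Bi]|_] := boolP (w \in A); last exact: sumr_ge0.
rewrite (bigD1 i)//= indicE mem_set// lerDl.
exact: sumr_ge0.
Qed.

Lemma Pr_leU (N A B C : set T) : measurable A -> measurable B ->
  measurable C -> measurable N -> Pr P N = 0 ->
  (forall w, ~ N w -> A w -> B w \/ C w) -> Pr P A <= Pr P B + Pr P C.
Proof.
move=> mA mB mC mN N0 AB.
have -> : Pr P B + Pr P C =
    \sum_(i < 2) Pr P ((fun i : 'I_2 => if val i == 0%N then B else C) i).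
  by rewrite big_ord_recr big_ord1.
apply: (@Pr_le_sum _ N) => //; first by move=> i; case: ifP.
by move=> w Nw /(AB w Nw)[Bw|Cw]; [exists ord0|exists ord_max].
Qed.

(** Bonferroni's second inequality, with the pair terms counted twice. *)
Lemma Pr_bonferroni (N B : set T) (n : nat) (A : 'I_n -> set T) :
  measurable B -> (forall i, measurable (A i)) ->
  measurable N -> Pr P N = 0 ->
  (forall w i, ~ N w -> A i w -> B w) ->
  \sum_i Pr P (A i) <=
    Pr P B + \sum_i \sum_(j | j != i) Pr P (A i `&` A j).
Proof.
move=> mB mA mN N0 AB.
rewrite pair_big_dep/=.
pose c (o : option ('I_n + 'I_n * 'I_n)) : R := match o with
  | None => 1 | Some (inl _) => -1 | Some (inr p) => (p.2 != p.1)%:R end.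
pose S (o : option ('I_n + 'I_n * 'I_n)) : set T := match o with
  | None => B | Some (inl i) => A i | Some (inr p) => A p.1 `&` A p.2 end.
have E (F : option ('I_n + 'I_n * 'I_n) -> R) : \sum_o F o =
    F None + (\sum_i F (Some (inl i)) + \sum_p F (Some (inr p))).
  by rewrite big_option_sum big_sumType/=.
have := @Pr_sum_ge0 _ c S N.
rewrite E /c /S /=.
have -> : \sum_i -1 * Pr P (A i) = - \sum_i Pr P (A i).
  by rewrite -sumrN; apply: eq_bigr => i _; rewrite mulN1r.
have -> : \sum_(p : 'I_n * 'I_n) (p.2 != p.1)%:R * Pr P (A p.1 `&` A p.2) =
    \sum_(p : 'I_n * 'I_n | p.2 != p.1) Pr P (A p.1 `&` A p.2).
  rewrite [RHS]big_mkcond/=; apply: eq_bigr => p _.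
  by case: ifP => _; rewrite ?mul1r ?mul0r.
rewrite mul1r => H.
suff : 0 <= Pr P B + (- (\sum_i Pr P (A i)) +
    \sum_(p : 'I_n * 'I_n | p.2 != p.1) Pr P (A p.1 `&` A p.2)) by lra.
apply: H => //.
  by case=> [[i|p]|]//=; exact: measurableI.
move=> w Nw; rewrite E /=.
have -> : \sum_i -1 * \1_(A i) w = - \sum_i \1_(A i) w :> R.
  by rewrite -sumrN; apply: eq_bigr => i _; rewrite mulN1r.
rewrite mul1r.
have Pge0 : 0 <= \sum_(p : 'I_n * 'I_n) (p.2 != p.1)%:R *
    \1_(A p.1 `&` A p.2) w :> R.
  by apply: sumr_ge0 => p _; rewrite mulr_ge0.
have [[i Ai]|noA] := pselect (exists i, A i w); last first.
  have -> : \sum_i \1_(A i) w = 0 :> R.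
    apply: big1 => i _; rewrite indicE memNset// => Ai.
    by apply: noA; exists i.
  by rewrite oppr0 add0r addr_ge0.
rewrite indicE mem_set; last exact: (AB w i).
rewrite /= mulr1n.
suff : \sum_i \1_(A i) w <= 1 + \sum_(p : 'I_n * 'I_n) (p.2 != p.1)%:R *
    \1_(A p.1 `&` A p.2) w :> R by lra.
rewrite (bigD1 i)//= lerD//.
rewrite -(pair_bigA _ (fun a b => (b != a)%:R * \1_(A a `&` A b) w))/=.
rewrite [leRHS](bigD1 i)//= -[leLHS]addr0 lerD//; last first.
  by apply: sumr_ge0 => k _; apply: sumr_ge0 => l _; rewrite mulr_ge0.
rewrite [leLHS]big_mkcond/=; apply: ler_sum => j _.
case: ifP => ji; last by rewrite mulr_ge0.
rewrite mul1r !indicE; have [/set_mem Aj|_] := boolP (w \in A j) => //.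
by rewrite mem_set.
Qed.

(** Markov's inequality for a product of step functions: the expectation of
    the expanded product is a sum of probabilities of orthants. *)
Lemma Pr_prod_step (n : nat) (J : finType) (A : 'I_n -> J -> set T) (c p : J -> R)
    (M a : R) (N E : set T) :
  (forall i k, measurable (A i k)) -> measurable E ->
  measurable N -> Pr P N = 0 -> (forall k, 0 <= c k) ->
  (forall k : {ffun 'I_n -> J},
     Pr P (\bigcap_(i in [set: 'I_n]) A i (k i)) <= M * \prod_i p (k i)) ->
  (forall w, ~ N w -> E w -> a <= \prod_(i < n) \sum_k c k * \1_(A i k) w) ->
  a * Pr P E <= M * (\sum_k c k * p k) ^+ n.
Proof.
move=> mA mE mN N0 c0 orth aE.
pose cap (k : {ffun 'I_n -> J}) := \bigcap_(i in [set: 'I_n]) A i (k i).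
have mcap k : measurable (cap k).
  apply: fin_bigcap_measurable; last by move=> i _.
  exact: finite_finset.
have capE w k : \1_(cap k) w = \prod_i \1_(A i (k i)) w :> R.
  have [/set_mem Aw|/negP nAw] := boolP (w \in cap k).
    rewrite indicE mem_set//; apply/esym/big1 => i _.
    by rewrite indicE mem_set//; exact: Aw.
  have /existsNP[i /not_implyP[_ Ai]] : ~ cap k w.
    by move=> cw; apply: nAw; exact/mem_set.
  rewrite indicE memNset; last by move=> cw; apply: nAw; exact/mem_set.
  by rewrite (bigD1 i)//= indicE memNset// mul0r.
have prodE w : \prod_(i < n) \sum_k c k * \1_(A i k) w =
    \sum_(k : {ffun 'I_n -> J}) (\prod_i c (k i)) * \1_(cap k) w.
  rewrite bigA_distr_bigA/=; apply: eq_bigr => k _.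
  by rewrite big_split/= capE.
have := @Pr_sum_ge0 _
  (fun o => if o is Some k then \prod_i c ((k : {ffun _ -> _}) i) else - a)
  (fun o => if o is Some k then cap k else E) N.
rewrite big_option_sum mulNr addrC subr_ge0 => H.
apply: (le_trans (H _ mN N0 _)).
- by case.
- move=> w Nw; rewrite big_option_sum mulNr addrC subr_ge0 -prodE indicE.
  have [/set_mem Ew|_] := boolP (w \in E); first by rewrite mulr1 aE.
  rewrite mulr0; apply: prodr_ge0 => i _; apply: sumr_ge0 => k _.
  by rewrite mulr_ge0.
- have -> : M * (\sum_k c k * p k) ^+ n =
    \sum_(k : {ffun 'I_n -> J}) (\prod_i c (k i)) * (M * \prod_i p (k i)).
    have -> : (\sum_k c k * p k) ^+ n = \prod_(i < n) \sum_k c k * p k.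
      by rewrite prodr_const card_ord.
    rewrite bigA_distr_bigA/= mulr_sumr; apply: eq_bigr => k _.
    by rewrite big_split/= mulrCA.
  apply: ler_sum => k _; rewrite ler_wpM2l//; last exact: orth.
  exact: prodr_ge0.
Qed.

End finite_linear_inequalities.

(** * Tails and means of distributions on the half-line *)

Section grid.
Context (R : realType).
Implicit Types D x : R.

(** The number of grid points [D, 2 * D, ..., K * D] below [x], times [D], is [x]
    truncated at [K * D] up to an error [D]; this replaces integrals of tails
    by finite sums. *)
Lemma grid_le D K x : 0 < D -> 0 <= x ->
  \sum_(k < K) D * (k.+1%:R * D < x)%R%:R <= Num.min x (K%:R * D).
Proof.
move=> D0 x0; elim: K => [|K IH]; first by rewrite big_ord0 mul0r le_min x0/=.
rewrite big_ord_recr/=; move: IH; rewrite !le_min => /andP[IHx IHK].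
have [lt|ge] := ltP (K.+1%:R * D) x; last first.
  by rewrite mulr0 addr0 IHx/= (le_trans IHK)// ler_pM2r// ler_nat.
rewrite mulr1 -[K.+1]addn1 natrD mulrDl mul1r lerD2r IHK andbT.
by rewrite (le_trans _ (ltW lt))// -[K.+1]addn1 natrD mulrDl mul1r lerD2r.
Qed.

Lemma grid_ge D K x : 0 < D ->
  Num.min x (K.+1%:R * D) <= D + \sum_(k < K) D * (k.+1%:R * D < x)%R%:R.
Proof.
move=> D0; elim: K => [|K IH]; first by rewrite big_ord0 mul1r addr0 ge_min lexx orbT.
rewrite big_ord_recr/=.
have [lt|ge] := ltP (K.+1%:R * D) x; last first.
  rewrite mulr0 addr0; apply: le_trans IH.
  by rewrite le_min ge_min lexx/= ge_min ge.
rewrite mulr1 addrA.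
have : K.+1%:R * D <= D + \sum_(k < K) D * (k.+1%:R * D < x)%R%:R.
  by apply: le_trans IH; rewrite le_min lexx ltW.
move=> H; apply: (@le_trans _ _ (K.+2%:R * D)); first by rewrite ge_min lexx orbT.
by rewrite -[K.+2]addn1 natrD mulrDl mul1r lerD2r.
Qed.

End grid.

Section distribution_tail.
Context (R : realType) (F : probability (measurableTypeR R) R).
Implicit Types D x r eps : R.

Lemma tailE x : tail F x = Pr F `]x, +oo[.
Proof.
rewrite /tail /Pr -setCitvl probability_setC//.
by rewrite fineB// ?fin_num_measure.
Qed.

Lemma tail_ge0 x : 0 <= tail F x.
Proof. by rewrite tailE Pr_ge0. Qed.

Lemma tail_le1 x : tail F x <= 1.
Proof. by rewrite tailE; exact: Pr_le1. Qed.

Lemma tail_nonincreasing x y : x <= y -> tail F y <= tail F x.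
Proof.
move=> xy; rewrite !tailE; apply: (@Pr_le _ _ _ _ set0) => //.
  by rewrite /Pr measure0.
by move=> w _ /=; rewrite !in_itv/= !andbT; exact: le_lt_trans.
Qed.

Hypothesis F_ge0 : Pr F `[0, +oo[ = 1.

Lemma Pr_lt0_eq0 : Pr F `]-oo, 0[ = 0.
Proof.
rewrite -setCitvr /Pr probability_setC//.
rewrite fineB ?fin_num_measure//=.
by move: F_ge0; rewrite /Pr => ->; rewrite subrr.
Qed.

Lemma tail_lt0 x : x < 0 -> tail F x = 1.
Proof.
move=> x0; apply/eqP; rewrite eq_le tail_le1/= -F_ge0 tailE.
apply: (@Pr_le _ _ _ _ set0) => //; first by rewrite /Pr measure0.
by move=> w _ /=; rewrite !in_itv/= !andbT; exact: lt_le_trans.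
Qed.

Section finite_mean.
Variable mu : R.
Hypothesis F_mean : mean F = mu%:E.

Let pos_part_mean : (\int[F]_x (Num.max x 0)%:E = mu%:E)%E.
Proof.
rewrite -F_mean /mean; apply: ae_eq_integral => //.
- apply/measurable_EFinP; apply: measurable_funrpos; exact: measurable_id.
- exists `]-oo, 0[%classic; split => //.
    by apply: Pr_eq0; [exact: measurable_itv|exact: Pr_lt0_eq0].
  move=> x /= H; rewrite in_itv/= ltNge; apply/negP => x0; apply: H => _ /=.
  by rewrite max_l.
Qed.

Let gt_indic (r : R) :
  (fun x : R => (r < x)%R%:R) = \1_`]r, +oo[%classic :> (_ -> R).
Proof.
apply/funext => x; rewrite indicE; congr (nat_of_bool _)%:R.
by apply/idP/idP => [h|/set_mem/=]; [apply/mem_set|]; rewrite /= in_itv/= andbT.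
Qed.

Let integral_gt (D r : R) : 0 <= D ->
  (\int[F]_x (D * (r < x)%R%:R)%:E = (D * tail F r)%:E)%E.
Proof.
move=> D0; have gtE x : (r < x)%R%:R = \1_`]r, +oo[%classic x :> R.
  by rewrite -gt_indic.
under eq_integral do rewrite gtE EFinM.
rewrite ge0_integralZl//; last first.
  by apply/measurable_EFinP; apply: measurable_indic; exact: measurable_itv.
by rewrite integral_indic// setIT tailE EFinM /Pr fineK// fin_num_measure.
Qed.

Let measurable_gt (D r : R) :
  measurable_fun setT (fun x : measurableTypeR R => (D * (r < x)%R%:R)%:E).
Proof.
apply/measurable_EFinP; apply: measurable_funM => //.
by rewrite gt_indic; apply: measurable_indic; exact: measurable_itv.
Qed.

(** Lower Riemann sums of the tail stay below its integral, which is the mean. *)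
Lemma sum_tail_le_mean D K : 0 < D ->
  \sum_(k < K) D * tail F (k.+1%:R * D) <= mu.
Proof.
move=> D0; rewrite -lee_fin -pos_part_mean -sumEFin.
under eq_bigr do rewrite -integral_gt ?(ltW D0)//.
rewrite -ge0_integral_sum//; last first.
- by move=> k x _; rewrite lee_fin mulr_ge0// ltW.
apply: ge0_le_integral => //.
- by move=> x _; apply: sume_ge0 => k _; rewrite lee_fin mulr_ge0// ltW.
- by apply: emeasurable_sum => k; exact: measurable_gt.
- apply/measurable_EFinP; apply: measurable_funrpos; exact: measurable_id.
- move=> x _; rewrite sumEFin lee_fin; have [x0|x0] := ltP x 0.
    rewrite big1// => k _.
    by rewrite ltNge (le_trans (ltW x0))/= ?mulr0// mulr_ge0// ltW.
  apply: le_trans (grid_le K D0 x0) _.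
  by rewrite ge_min lexx.
Qed.

(** Rounding down to a grid of mesh [D] loses at most [D] of the mean, and the
    rounded mean is the limit of the partial sums. *)
Lemma mean_lt_sum_tail eps : 0 < eps ->
  exists D K, 0 < D /\ mu - eps < \sum_(k < K) D * tail F (k.+1%:R * D).
Proof.
move=> e0; exists (eps / 2); pose D := eps / 2; have D0 : 0 < D by rewrite divr_gt0.
apply: contrapT => /forallNP H.
have {}H K : \sum_(k < K) D * tail F (k.+1%:R * D) <= mu - eps.
  by rewrite leNgt; apply/negP => h; apply: (H K).
suff : mu <= D + (mu - eps) by rewrite /D; lra.
rewrite -lee_fin -pos_part_mean EFinD.
pose u (k : nat) (x : R) : \bar R := (D * (k.+1%:R * D < x)%R%:R)%:E.
have u0 k x : (0 <= u k x)%E by rewrite lee_fin mulr_ge0// ltW.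
have mu_ k : measurable_fun setT (u k : measurableTypeR R -> _) by exact: measurable_gt.
apply: (@le_trans _ _ (\int[F]_x (D%:E + \sum_(0 <= k <oo) u k x))%E).
  apply: ge0_le_integral => //.
  - by move=> x _; rewrite lee_fin le_max lexx orbT.
  - apply/measurable_EFinP; apply: measurable_funrpos; exact: measurable_id.
  - apply: emeasurable_funD => //.
    by apply: ge0_emeasurable_sum => // k x _ _; exact: u0.
  move=> x _; have [x0|x0] := ltP x 0.
    rewrite adde_ge0 ?lee_fin ?(ltW D0)//.
    by apply: nneseries_ge0 => k _ _; exact: u0.
  have [K xK] : exists K : nat, x <= K.+1%:R * D.
    exists (Num.truncn (x / D)); rewrite -ler_pdivrMr//.
    by rewrite ltW// truncnS_gt.
  apply: (@le_trans _ _ (D%:E + \sum_(0 <= k < K) u k x)%E); last first.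
    by rewrite leeD2l//; apply: nneseries_lim_ge => k _ _; exact: u0.
  rewrite big_mkord sumEFin -EFinD lee_fin.
  by apply: le_trans (grid_ge K x D0); rewrite le_min lexx.
rewrite ge0_integralD//; last 3 first.
- by move=> x _; rewrite lee_fin ltW.
- by move=> x _; apply: nneseries_ge0 => k _ _; exact: u0.
- by apply: ge0_emeasurable_sum => // k x _ _; exact: u0.
have -> : (\int[F]_x D%:E = D%:E)%E.
  rewrite integral_cst// -[RHS]mule1; congr (_ * _)%E.
  exact: probability_setT.
rewrite leeD2l//.
rewrite integral_nneseries//.
under eq_eseriesr do rewrite integral_gt ?(ltW D0)//.
apply: lime_le.
  by apply: is_cvg_nneseries => k _ _; rewrite lee_fin mulr_ge0 ?tail_ge0// ltW.
by near=> K; rewrite big_mkord sumEFin lee_fin H.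
Unshelve. all: by end_near.
Qed.

Lemma mul_tail_le_mean x : 0 < x -> x * tail F x <= mu.
Proof.
by move=> x0; have := sum_tail_le_mean 1 x0; rewrite big_ord1 mul1r.
Qed.

(** Once a partial sum over a grid is within [eps / 2] of the mean, the grid
    points between its end and [x], at least [x / (2 * D)] many, contribute at
    most [eps / 2], and each of them at least [D * tail F x]. *)
Lemma mul_tail_to0 eps : 0 < eps ->
  exists x0, 0 < x0 /\ forall x, x0 <= x -> x * tail F x <= eps.
Proof.
move=> e0; have [D [K [D0 H]]] := mean_lt_sum_tail (divr_gt0 e0 (ltr0n R 2)).
exists (2 * (K.+1%:R * D)); split; first by rewrite !mulr_gt0.
move=> x xK; have x0 : 0 < x by apply: lt_le_trans xK; rewrite !mulr_gt0.
pose K' := Num.truncn (x / D).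
have /andP[K'1 K'2] : K'%:R <= x / D < K'.+1%:R by rewrite truncn_itv// divr_ge0// ltW.
rewrite ler_pdivlMr// in K'1; rewrite ltr_pdivrMr// in K'2.
have KK' : (K <= K')%N.
  have : K.+1%:R < K'.+1%:R :> R.
    rewrite -(ltr_pM2r D0); apply: le_lt_trans K'2; apply: le_trans xK.
    by rewrite ler_peMl// ?mulr_ge0// ?ltW// ltr1n.
  by rewrite ltr_nat ltnS => /ltnW.
have := sum_tail_le_mean K' D0.
rewrite -(big_mkord xpredT (fun k => D * tail F (k.+1%:R * D))).
rewrite (big_cat_nat (n := K))//= big_mkord.
have : (K' - K)%:R * (D * tail F x) <= \sum_(K <= k < K') D * tail F (k.+1%:R * D).
  rewrite mulr_natl -[in leLHS]sumr_const_nat big_seq [leRHS]big_seq.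
  apply: ler_sum => k; rewrite mem_index_iota => /andP[_ kK'].
  rewrite ler_wpM2l ?(ltW D0)//; apply: tail_nonincreasing.
  by apply: le_trans K'1; rewrite ler_pM2r// ler_nat.
rewrite natrB// => h1 h2.
have h3 : (K'%:R - K%:R) * (D * tail F x) <= eps / 2 by lra.
have := tail_ge0 x; move: (tail F x) h3 => f h3 f0.
have : x / 2 <= (K'%:R - K%:R) * D.
  by move: xK K'2; rewrite -[K.+1]addn1 -[K'.+1]addn1 !natrD; lra.
move=> /(ler_wpM2r f0); lra.
Qed.

End finite_mean.
End distribution_tail.

(** * Exponential estimates *)

Section exponential_estimates.
Context (R : realType).

Lemma expRN_le_quadratic (u : R) : 0 <= u -> expR (- u) <= 1 - u + u ^+ 2.
Proof.
move=> u0; rewrite expRN -[leLHS]mul1r ler_pdivrMr ?expR_gt0//.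
apply: (@le_trans _ _ ((1 - u + u ^+ 2) * (1 + u))).
  have : 0 <= u ^+ 3 by rewrite exprn_ge0.
  by rewrite (_ : (1 - u + u ^+ 2) * (1 + u) = 1 + u ^+ 3); [lra|ring].
rewrite ler_wpM2l ?expR_ge1Dx//; nra.
Qed.

Lemma expR_le_affine (v : R) : 0 <= v -> v <= 1 / 2 -> expR v <= 1 + 2 * v.
Proof.
move=> v0 v1; have h : 1 - v <= expR (- v).
  by apply: le_trans (expR_ge1Dx _); lra.
rewrite -[expR v]invrK -expRN -[leLHS]mul1r ler_pdivrMr ?expR_gt0//.
apply: (@le_trans _ _ ((1 + 2 * v) * (1 - v))); first nra.
by rewrite ler_wpM2l//; lra.
Qed.

Lemma pow_le_expR (j : nat) (a : R) : 0 <= a ->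
  a ^+ j <= (2 * j.+1%:R) ^+ j * expR (a / 2).
Proof.
move=> a0; pose b := a / (2 * j.+1%:R).
have j0 : 0 < 2 * j.+1%:R :> R by rewrite mulr_gt0.
have b0 : 0 <= b by rewrite divr_ge0// ltW.
have -> : a = 2 * j.+1%:R * b by rewrite /b mulrC divfK// gt_eqF.
rewrite exprMn; apply: ler_wpM2l; first by rewrite exprn_ge0// ltW.
apply: (@le_trans _ _ (expR b ^+ j)).
  by rewrite lerXn2r ?nnegrE ?expR_ge0// (le_trans _ (expR_ge1Dx _))// lerDr.
rewrite -expRM_natr ler_expR mulrC.
rewrite (_ : 2 * j.+1%:R * b / 2 = j.+1%:R * b); last by field.
by rewrite ler_wpM2r// ler_nat.
Qed.

End exponential_estimates.

(** * Tails of consistent variation *)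

Section consistent_variation.
Context (R : realType) (F : probability (measurableTypeR R) R).
Hypothesis F_C : consistently_varying F.

Let tail_ratio eps : 0 < eps -> exists y x0 : R, 1 < y /\ 1 <= x0 /\
  forall x, x0 <= x -> 1 - eps < tail F (x * y) / tail F x.
Proof.
move=> e0.
have lt1 : ((1 - eps)%:E < 1%E :> \bar R)%E by rewrite lte_fin; lra.
have : \forall y \near (1 : R)^'+, ((1 - eps)%:E < lower_tail_ratio F y)%E.
  exact: (F_C (open_ereal_gt' lt1)).
move=> near1.
have [y [/= y1]] : exists y : R, 1 < y /\ ((1 - eps)%:E < lower_tail_ratio F y)%E.
  have /filter_ex[y [y1 yr]] : \forall y \near (1 : R)^'+,
      1 < y /\ ((1 - eps)%:E < lower_tail_ratio F y)%E.
    near=> y; split; near: y; [exact: nbhs_right_gt|exact: near1].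
  by exists y.
rewrite /lower_tail_ratio /limf_einf lteNr => /ereal_inf_lt[_ [V FV <-]].
rewrite -EFinN => supV; exists y.
move: FV => [x0 [_ x0V]]; exists (Num.max 1 (x0 + 1)); split => //.
split; first by rewrite le_max lexx.
move=> x; rewrite ge_max => /andP[x1 xx0].
have Vx : V x by apply: x0V; rewrite (lt_le_trans _ xx0)// ltrDl.
have : (- (tail F (x * y) / tail F x)%:E < (- (1 - eps))%:E)%E.
  apply: le_lt_trans supV; apply: ereal_sup_ubound; exists x => //.
by rewrite -EFinN lte_fin ltrN2.
Unshelve. all: by end_near.
Qed.

(** Ratios of the tail are close to one far out, whereas a vanishing tail would
    make them zero, division by zero being zero. *)
Lemma tail_gt0 x : 0 < tail F x.
Proof.
have [y [x0 [_ [_ H]]]] := @tail_ratio (1/2) ltac:(lra).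
rewrite (lt_le_trans _ (tail_nonincreasing F (y := Num.max x x0) _))//; last first.
  by rewrite le_max lexx.
have := H (Num.max x x0); rewrite le_max lexx orbT => /(_ isT) h.
rewrite lt_neqAle tail_ge0 andbT eq_sym; apply/eqP => h0.
by move: h; rewrite h0 invr0 mulr0; lra.
Qed.

Lemma consistent_variation eps : 0 < eps ->
  exists eta x0, 0 < eta <= 1 /\ 1 <= x0 /\
  forall x y, x0 <= x -> y <= (1 + eta) * x ->
    (1 - eps) * tail F x <= tail F y.
Proof.
move=> e0; have [y [x0 [y1 [x01 H]]]] := tail_ratio e0.
exists (Num.min 1 (y - 1)), x0; split.
  by rewrite lt_min ltr01 subr_gt0 y1/= ge_min lexx.
split=> // x z xx0 zx.
have := H x xx0; rewrite ltr_pdivlMr ?tail_gt0// => /ltW/le_trans; apply.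
apply: tail_nonincreasing; rewrite mulrC; apply: (le_trans zx).
rewrite ler_wpM2r//; first lra.
by rewrite -lerBrDl ge_min lexx orbT.
Qed.

(** Iterating one consistent-variation step gives polynomial decay; since the
    tail is bounded by one, the bound then extends to all arguments. *)
Lemma potter : exists (C : R) (p : nat), 1 <= C /\
  forall m lam, 1 <= lam -> tail F m <= C * lam ^+ p * tail F (lam * m).
Proof.
have [eta [x0 [/andP[eta0 _] [x01 H]]]] := @consistent_variation (1/2) ltac:(lra).
pose b := 1 + eta; have b1 : 1 < b by rewrite /b ltrDl.
have b0 : 0 < b by lra.
have [p bp] : exists p : nat, 2 <= b ^+ p.
  exists (Num.truncn (2 / eta)).+1.
  have : 1 + (Num.truncn (2 / eta)).+1%:R * eta <= b ^+ (Num.truncn (2 / eta)).+1.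
    have e1 : -1 <= eta by lra.
    elim: (Num.truncn _).+1 => [|n IH]; first by rewrite mul0r addr0 expr0.
    rewrite exprS; apply: (@le_trans _ _ (b * (1 + n%:R * eta))).
      rewrite /b -[n.+1]addn1 natrD; have : 0 <= n%:R :> R by []; nra.
    by rewrite ler_wpM2l// ltW.
  apply: le_trans; have := truncnS_gt (2 / eta).
  by rewrite ltr_pdivrMr//; lra.
have step x : x0 <= x -> tail F x <= 2 * tail F (b * x).
  by move=> xx0; have := H x (b * x) xx0 (lexx _); lra.
have iter j lam x : 1 <= lam -> lam <= b ^+ j -> x0 <= x ->
    tail F x <= 2 * lam ^+ p * tail F (lam * x).
  elim: j lam x => [|j IH] lam x l1 lj xx0.
    have -> : lam = 1 by apply/le_anti; rewrite l1 -(expr0 b) lj.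
    rewrite expr1n mulr1 mul1r; have := tail_ge0 F x; lra.
  have x1 : 0 < x by lra.
  have [lb|lb] := leP lam b.
    apply: (le_trans (step x xx0)); rewrite -mulrA ler_pM2l//.
    apply: (@le_trans _ _ (tail F (lam * x))).
      by apply: tail_nonincreasing; rewrite ler_pM2r.
    by rewrite ler_peMl ?tail_ge0// exprn_ege1.
  pose l := lam / b.
  have l1' : 1 <= l by rewrite /l ler_pdivlMr// mul1r ltW.
  have lj' : l <= b ^+ j by rewrite /l ler_pdivrMr// -exprSr.
  have lE : lam = b * l by rewrite /l mulrC divfK// gt_eqF.
  clearbody l.
  apply: (le_trans (IH _ _ l1' lj' xx0)).
  have lx : x0 <= l * x by apply: (le_trans xx0); rewrite ler_peMl// ltW.
  have := step _ lx; rewrite mulrA -lE => h.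
  rewrite lE exprMn -lE.
  have lp0 : 0 <= l ^+ p by rewrite exprn_ge0//; lra.
  apply: (@le_trans _ _ (2 * l ^+ p * (2 * tail F (lam * x)))).
    by rewrite ler_wpM2l// mulr_ge0.
  have := tail_ge0 F (lam * x); move: (tail F (lam * x)) => f f0.
  have : 2 * (l ^+ p * f) <= b ^+ p * (l ^+ p * f).
    by rewrite ler_wpM2r// mulr_ge0.
  by lra.
have iter' lam x : 1 <= lam -> x0 <= x ->
    tail F x <= 2 * lam ^+ p * tail F (lam * x).
  move=> l1 xx0.
  have [j lj] : exists j, lam <= b ^+ j.
    exists (Num.truncn (lam / eta)).+1.
    have : 1 + (Num.truncn (lam / eta)).+1%:R * eta <=
        b ^+ (Num.truncn (lam / eta)).+1.
      elim: (Num.truncn _).+1 => [|n IH]; first by rewrite mul0r addr0 expr0.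
      rewrite exprS; apply: (@le_trans _ _ (b * (1 + n%:R * eta))).
        rewrite /b -[n.+1]addn1 natrD; have : 0 <= n%:R :> R by []; nra.
      by rewrite ler_wpM2l// ltW.
    apply: le_trans; have := truncnS_gt (lam / eta).
    by rewrite ltr_pdivrMr//; lra.
  exact: iter l1 lj xx0.
have f0 := tail_gt0 x0.
exists (2 / tail F x0), p; split.
  by rewrite ler_pdivlMr// mul1r; have := tail_le1 F x0; lra.
move=> m lam l1.
have lp1 : 1 <= lam ^+ p by rewrite exprn_ege1.
have C2 : 2 <= 2 / tail F x0.
  by rewrite ler_pdivlMr// -[leRHS]mulr1 ler_pM2l// tail_le1.
have [mx0|mx0] := leP x0 m.
  apply: (le_trans (iter' _ _ l1 mx0)).
  by rewrite ler_wpM2r ?tail_ge0// ler_pM2r//; lra.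
have t1 := tail_le1 F m.
have [lx|lx] := leP (lam * m) x0.
  have := tail_nonincreasing F lx => h.
  apply: (le_trans t1).
  apply: (@le_trans _ _ (2 / tail F x0 * tail F (lam * m))); last first.
    by rewrite ler_wpM2r ?tail_ge0// ler_peMr//; lra.
  by rewrite mulrAC ler_pdivlMr// mul1r; have := tail_ge0 F (lam * m); lra.
apply: (le_trans t1).
have l2 : 1 <= lam * m / x0 by rewrite ler_pdivlMr ?mul1r; lra.
have := iter' _ _ l2 (lexx _); rewrite divfK ?gt_eqF//; last by lra.
have lm : lam * m / x0 <= lam.
  by rewrite ler_pdivrMr; [rewrite ler_pM2l; lra|lra].
have h1 : (lam * m / x0) ^+ p <= lam ^+ p.
  by rewrite lerXn2r// nnegrE; lra.
rewrite (_ : 2 / tail F x0 * lam ^+ p * _ =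
  (2 * lam ^+ p * tail F (lam * m)) / tail F x0); last by rewrite -!mulrA; congr (_ * _); rewrite mulrC -!mulrA.
rewrite ler_pdivlMr// mul1r => /le_trans; apply.
by rewrite ler_wpM2r ?tail_ge0// ler_pM2l.
Qed.

Lemma tail_scale rho : 0 < rho ->
  exists C, 0 < C /\ forall x, 0 <= x -> tail F (rho * x) <= C * tail F x.
Proof.
move=> r0; have [r1|r1] := leP 1 rho.
  exists 1; split=> // x x0; rewrite mul1r; apply: tail_nonincreasing.
  by rewrite ler_peMl.
have [C [p [C1 pot]]] := potter; exists (C * rho^-1 ^+ p).
split; first by rewrite mulr_gt0 ?exprn_gt0 ?invr_gt0//; lra.
move=> x x0; have ri : 1 <= rho^-1 by rewrite invf_ge1// ltW.
by have := pot (rho * x) _ ri; rewrite mulKf// gt_eqF.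
Qed.

(** Consistently varying tails decay at most polynomially, so exponentially
    small probabilities are negligible against them. *)
Lemma expR_le_tail c A eps : 0 < c -> 0 < A -> 0 < eps ->
  exists n0 : nat, (0 < n0)%N /\ forall n x, (n0 <= n)%N -> x <= A * n%:R ->
    expR (- (c * n%:R)) <= eps * n%:R * tail F x.
Proof.
move=> c0 A0 e0; have [C [p [C1 pot]]] := potter.
have G1 := tail_gt0 1.
pose B := (2 * p.+1%:R) ^+ p : R.
have B0 : 0 < B by rewrite exprn_gt0// mulr_gt0.
pose A1 := A + 1.
have A10 : 0 < A1 by rewrite /A1; lra.
pose Q := B * C * A1 ^+ p / (c ^+ p * tail F 1 * eps).
have Q0 : 0 < Q.
  rewrite divr_gt0// !mulr_gt0 ?exprn_gt0//; lra.
exists (Num.truncn Q).+1; split=> // n x n0 xA.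
have nQ : Q <= n%:R.
  by apply/ltW/(lt_le_trans (truncnS_gt Q)); rewrite ler_nat.
have n1 : 1 <= n%:R :> R by rewrite ler1n (leq_trans _ n0).
have npos : 0 < n%:R :> R by lra.
have h1 : tail F 1 <= C * (A1 * n%:R) ^+ p * tail F x.
  have l1 : 1 <= A1 * n%:R by rewrite /A1; nra.
  have := pot 1 _ l1; rewrite mulr1 => /le_trans; apply.
  rewrite ler_wpM2l//; first by rewrite mulr_ge0 ?exprn_ge0 ?mulr_ge0//; lra.
  by apply: tail_nonincreasing; apply: (le_trans xA); rewrite ler_wpM2r// /A1; lra.
have h2 : (c * n%:R) ^+ p <= B * expR (c * n%:R).
  have cn0 : 0 <= c * n%:R by rewrite mulr_ge0// ltW.
  apply: (le_trans (pow_le_expR p cn0)).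
  by rewrite ler_pM2l// ler_expR; lra.
rewrite expRN -[leLHS]mul1r ler_pdivrMr ?expR_gt0//.
have k1 : 0 < c ^+ p * tail F 1 by rewrite mulr_gt0 ?exprn_gt0.
rewrite -(ler_pM2l k1) mulr1.
have h3 : Q * (c ^+ p * tail F 1 * eps) = B * C * A1 ^+ p.
  by rewrite /Q divfK// gt_eqF// mulr_gt0.
have f0 := tail_gt0 x.
apply: (@le_trans _ _ (c ^+ p * (C * (A1 * n%:R) ^+ p * tail F x))).
  by rewrite ler_pM2l ?exprn_gt0.
rewrite exprMn in h1 *; rewrite exprMn in h2.
apply: (@le_trans _ _ (C * A1 ^+ p * tail F x * (B * expR (c * n%:R)))).
  rewrite (_ : c ^+ p * _ = C * A1 ^+ p * tail F x * (c ^+ p * n%:R ^+ p)); last by ring.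
  by rewrite ler_wpM2l// !mulr_ge0 ?exprn_ge0 ?(ltW f0) ?(ltW A10)//; lra.
rewrite (_ : C * _ * _ * _ = B * C * A1 ^+ p * (tail F x * expR (c * n%:R))); last by ring.
rewrite -h3 [leRHS](_ : _ = n%:R * (c ^+ p * tail F 1 * eps) * (tail F x * expR (c * n%:R))); last by ring.
rewrite ler_wpM2r ?mulr_ge0 ?expR_ge0 ?(ltW f0)// ler_wpM2r//.
by rewrite ltW// mulr_gt0.
Qed.

End consistent_variation.

(** * Orthant inequalities *)

Section measurable_events.
Context d (T : measurableType d) (R : realType).
Implicit Types f g : T -> R.

Lemma measurable_set_gt f x : measurable_fun setT f ->
  measurable [set w | f w > x].
Proof.
move=> mf; rewrite (_ : [set _ | _] = setT `&` f @^-1` `]x, +oo[).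
  by apply: mf => //; exact: measurable_itv.
by apply/seteqP; split => w /=; rewrite ?in_itv/= andbT => // -[].
Qed.

Lemma measurable_set_le f x : measurable_fun setT f ->
  measurable [set w | f w <= x].
Proof.
move=> mf; rewrite (_ : [set _ | _] = ~` [set w | f w > x]).
  by apply: measurableC; exact: measurable_set_gt.
by apply/seteqP; split => w /=; rewrite leNgt => /negP.
Qed.

Lemma measurable_set_lt f x : measurable_fun setT f ->
  measurable [set w | f w < x].
Proof.
move=> mf; rewrite (_ : [set _ | _] = setT `&` f @^-1` `]-oo, x[).
  by apply: mf => //; exact: measurable_itv.
by apply/seteqP; split => w /=; rewrite ?in_itv/= => // -[].
Qed.

End measurable_events.

(** The null event off which all the variables are nonnegative. *)
Definition some_negative (T : Type) (R : realType) (X : nat -> T -> R) : set T :=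
  \bigcup_i [set w | X i w < 0].

Section common_distribution.
Context d (T : measurableType d) (R : realType) (P : probability T R).
Variables (X : nat -> {RV P >-> R}) (F : probability (measurableTypeR R) R).
Hypothesis X_F : forall i, has_distribution (X i) F.

Lemma measurable_RV i : measurable_fun setT (X i : T -> R).
Proof. exact: measurable_funPT. Qed.

Lemma measurable_sum_RV n :
  measurable_fun setT (fun w => \sum_(i < n) X i w : R).
Proof. by apply: measurable_sum => i; exact: measurable_RV. Qed.

Lemma measurable_sum_minRV n (L : R) :
  measurable_fun setT (fun w => \sum_(i < n) Num.min (X i w) L).
Proof.
by apply: measurable_sum => i; exact: measurable_minr.
Qed.

Lemma Pr_RV_gt i x : Pr P [set w | X i w > x] = tail F x.
Proof.
rewrite tailE /Pr -(X_F i); last exact: measurable_itv.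
congr (fine (P _)); apply/seteqP.
by split => w /=; rewrite in_itv/= andbT.
Qed.

Lemma Pr_RV_le i x : Pr P [set w | X i w <= x] = 1 - tail F x.
Proof.
rewrite /tail subKr /Pr -(X_F i); last exact: measurable_itv.
by congr (fine (P _)).
Qed.

Hypothesis F_ge0 : Pr F `[0, +oo[ = 1.

Lemma measurable_some_negative : measurable (some_negative X).
Proof.
apply: bigcupT_measurable => i; apply: measurable_set_lt; exact: measurable_RV.
Qed.

Lemma Pr_some_negative : Pr P (some_negative X) = 0.
Proof.
rewrite /Pr (_ : P _ = 0%E)//; apply/negligibleP; first exact: measurable_some_negative.
apply: negligible_bigcup => i; apply/negligibleP.
  by apply: measurable_set_lt; exact: measurable_RV.
apply: Pr_eq0; first by apply: measurable_set_lt; exact: measurable_RV.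
transitivity (Pr F `]-oo, 0[); last exact: Pr_lt0_eq0.
rewrite /Pr -(X_F i); last exact: measurable_itv.
by by congr (fine (P _)).
Qed.

Lemma not_some_negative w i : ~ some_negative X w -> 0 <= X i w.
Proof. by move=> Nw; rewrite leNgt; apply/negP => h; apply: Nw; exists i. Qed.

Variable M : R.
Hypothesis X_ENOD : ENOD X M.

Lemma ENOD_coef_gt0 : 0 < M. Proof. by case: X_ENOD. Qed.

Let extend n (r : 'I_n -> R) (i : nat) : R :=
  if insub i is Some j then r j else 0.

Let extendE n (r : 'I_n -> R) (i : 'I_n) : extend r i = r i.
Proof. by rewrite /extend valK. Qed.

Let orthant n (r : 'I_n -> R) (Q : nat -> R -> set T) :
  \bigcap_(i in [set i | (i < n)%N]) Q i (extend r i) =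
  \bigcap_(i in [set: 'I_n]) Q i (r i).
Proof.
apply/seteqP; split => w H i /=.
  by move=> _; rewrite -extendE; apply: H => /=.
move=> ilt; have := H (Ordinal ilt) I.
by rewrite -(extendE r (Ordinal ilt)).
Qed.

Lemma ENOD_gt n (r : 'I_n -> R) : (0 < n)%N ->
  Pr P (\bigcap_(i in [set: 'I_n]) [set w | X i w > r i]) <=
    M * \prod_i tail F (r i).
Proof.
move=> n0; have [_ /(_ n n0 (extend r))[]] := X_ENOD => + _.
rewrite (orthant r (fun i x => [set w | X i w > x])) => /le_trans; apply.
rewrite ler_wpM2l ?(ltW ENOD_coef_gt0)//; apply: eq_ler.
by apply: eq_bigr => i _; rewrite extendE Pr_RV_gt.
Qed.

Lemma ENOD_le n (r : 'I_n -> R) : (0 < n)%N ->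
  Pr P (\bigcap_(i in [set: 'I_n]) [set w | X i w <= r i]) <=
    M * \prod_i (1 - tail F (r i)).
Proof.
move=> n0; have [_ /(_ n n0 (extend r))[_]] := X_ENOD.
rewrite (orthant r (fun i x => [set w | X i w <= x])) => /le_trans; apply.
rewrite ler_wpM2l ?(ltW ENOD_coef_gt0)//; apply: eq_ler.
by apply: eq_bigr => i _; rewrite extendE Pr_RV_le.
Qed.

(** The other coordinates get the threshold [-1], which nonnegative variables
    exceed almost surely. *)
Lemma ENOD_pair n (i j : 'I_n) x : i != j ->
  Pr P ([set w | X i w > x] `&` [set w | X j w > x]) <= M * tail F x ^+ 2.
Proof.
move=> ij; have n0 : (0 < n)%N by apply: leq_trans (ltn_ord i).
have := @ENOD_gt n (fun k => if (k == i) || (k == j) then x else -1) n0.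
rewrite (bigD1 i)//= eqxx/= (bigD1 j)/=; last by rewrite eq_sym.
rewrite eqxx orbT big1 ?mulr1; last first.
  by move=> k /andP[/negPf-> /negPf->]/=; rewrite tail_lt0// ltrN10.
rewrite -expr2; apply: le_trans.
apply: (@Pr_le _ _ _ _ (some_negative X)) => //.
- by apply: measurableI; apply: measurable_set_gt; exact: measurable_RV.
- apply: fin_bigcap_measurable; first exact: finite_finset.
  by move=> k _; apply: measurable_set_gt; exact: measurable_RV.
- exact: measurable_some_negative.
- exact: Pr_some_negative.
move=> w Nw [/= xi xj] k _ /=; case: ifP => [/orP[/eqP->|/eqP->]|_] //.
by apply: lt_le_trans (not_some_negative k Nw); rewrite ltrN10.
Qed.

(** The joint exponential moments needed in Chernoff bounds are those of
    nonnegative step functions of each variable. An increasing one is a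
    combination of indicators of upper half-lines, so that its product over
    the variables is a combination of indicators of upper orthants. *)
Lemma ENOD_gt_step n (J : finType) (c r : J -> R) (a : R) (E : set T) :
  (0 < n)%N -> measurable E -> (forall j, 0 <= c j) ->
  (forall w, ~ some_negative X w -> E w ->
    a <= \prod_(i < n) \sum_j c j * (r j < X i w)%R%:R) ->
  a * Pr P E <= M * (\sum_j c j * tail F (r j)) ^+ n.
Proof.
move=> n0 mE c0 H.
apply: (@Pr_prod_step _ _ _ _ n J (fun i j => [set w | X i w > r j])
   _ _ _ _ (some_negative X)) => //.
- by move=> i j; apply: measurable_set_gt; exact: measurable_RV.
- exact: measurable_some_negative.
- exact: Pr_some_negative.
- by move=> k; exact: ENOD_gt.
- move=> w Nw /(H w Nw) /le_trans; apply; apply: eq_ler; apply: eq_bigr => i _; apply: eq_bigr => j _; congr (_ * _).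
  by rewrite indicE; congr (nat_of_bool _)%:R; apply/idP/idP => [?|/set_mem//]; exact/mem_set.
Qed.

Lemma ENOD_le_step n (J : finType) (c r : J -> R) (a : R) (E : set T) :
  (0 < n)%N -> measurable E -> (forall j, 0 <= c j) ->
  (forall w, ~ some_negative X w -> E w ->
    a <= \prod_(i < n) \sum_j c j * (X i w <= r j)%R%:R) ->
  a * Pr P E <= M * (\sum_j c j * (1 - tail F (r j))) ^+ n.
Proof.
move=> n0 mE c0 H.
apply: (@Pr_prod_step _ _ _ _ n J (fun i j => [set w | X i w <= r j])
   _ _ _ _ (some_negative X)) => //.
- by move=> i j; apply: measurable_set_le; exact: measurable_RV.
- exact: measurable_some_negative.
- exact: Pr_some_negative.
- by move=> k; exact: ENOD_le.
- move=> w Nw /(H w Nw) /le_trans; apply; apply: eq_ler; apply: eq_bigr => i _; apply: eq_bigr => j _; congr (_ * _).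
  by rewrite indicE; congr (nat_of_bool _)%:R; apply/idP/idP => [?|/set_mem//]; exact/mem_set.
Qed.

End common_distribution.

(** * Exponential bounds for sums *)

Section chernoff.
Context d (T : measurableType d) (R : realType) (P : probability T R).
Variables (X : nat -> {RV P >-> R}) (F : probability (measurableTypeR R) R).
Hypothesis X_F : forall i, has_distribution (X i) F.
Hypothesis F_ge0 : Pr F `[0, +oo[ = 1.
Variables (mu M : R).
Hypothesis F_mean : mean F = mu%:E.
Hypothesis X_ENOD : ENOD X M.

Lemma mean_ge0 : 0 <= mu.
Proof.
by have := sum_tail_le_mean F_ge0 F_mean 0 (ltr01 : 0 < 1 :> R); rewrite big_ord0.
Qed.

(** Bounded below, the variables satisfy a Chernoff bound for their lower tail.
    The decreasing function [expR (- s * D)] of the rounded variable [D] is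
    replaced by [1 - kap * D], which dominates it and is affine in the
    indicators of lower half-lines. *)
Lemma lower_chernoff eps : 0 < eps ->
  exists L c, 0 <= L /\ 0 < c /\ forall n, (0 < n)%N ->
    Pr P [set w | \sum_(i < n) Num.min (X i w) L <= n%:R * (mu - eps)]
      <= M * expR (- (c * n%:R)).
Proof.
move=> e0; have mu0 := mean_ge0.
have [D [K [D0 nuH]]] := mean_lt_sum_tail F_ge0 F_mean (divr_gt0 e0 (ltr0n R 2)).
set nu := \sum_(k < K) _ in nuH.
pose L := K%:R * D; have L0 : 0 <= L by rewrite mulr_ge0// ltW.
have LE : L = K%:R * D by []; clearbody L.
pose s := eps / (4 * (L + 1) * (mu + eps)).
have den0 : 0 < 4 * (L + 1) * (mu + eps) by rewrite !mulr_gt0//; lra.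
have s0 : 0 < s by rewrite divr_gt0.
have sE : s * (L + 1) * (mu + eps) = eps / 4.
  have : s * (4 * (L + 1) * (mu + eps)) = eps by rewrite /s divfK// gt_eqF.
  by lra.
have sL1 : s * L <= 1.
  have : 0 <= s * L * mu by rewrite mulr_ge0// mulr_ge0// ltW.
  have : 0 <= s * (mu + eps) by rewrite mulr_ge0//; lra.
  have : s * L * eps <= eps / 4 -> s * L <= 1.
    move=> h; rewrite leNgt; apply/negP => h1; have : 0 < (s * L - 1) * eps by rewrite mulr_gt0//; lra.
    by lra.
  by move=> h; move: sE; rewrite !mulrDr !mulrDl !mulr1 => sE h1 h2; apply: h; lra.
have sLmu : s * (L * mu) <= eps / 4.
  rewrite -sE -mulrA ler_wpM2l ?(ltW s0)//.
  have : 0 <= L * eps by rewrite mulr_ge0// ltW.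
  by lra.
clearbody s.
pose kap := s - s ^+ 2 * L.
have kap_ge0 : 0 <= kap.
  by rewrite /kap (_ : s - s ^+ 2 * L = s * (1 - s * L)); [rewrite mulr_ge0//; lra|ring].
have kapL : kap * L <= 1.
  apply: le_trans sL1; rewrite ler_wpM2r// /kap gerBl.
  by rewrite mulr_ge0// exprn_ge0// ltW.
exists L, (s * eps / 4); split=> //; split; first by rewrite !mulr_gt0// invr_gt0.
move=> n n0; set E := [set w | _ <= _].
have mE : measurable E by apply: measurable_set_le; exact: measurable_sum_minRV.
have M0 := ENOD_coef_gt0 X_ENOD.
apply/ler_addgt0Pr => del del0.
(* the constant term of the step function needs an upper threshold, here r *)
have [r [r0 rH]] : exists r, 0 < r /\ n%:R * tail F r <= del.
  exists (n%:R * (mu + 1) / del).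
  have nr0 : 0 < n%:R :> R by rewrite ltr0n.
  have r0 : 0 < n%:R * (mu + 1) / del by rewrite divr_gt0// mulr_gt0//; lra.
  split=> //; have := mul_tail_le_mean F_ge0 F_mean r0.
  rewrite mulrAC ler_pdivrMr// => h.
  have mu1 : 0 < mu + 1 by lra.
  by rewrite -(ler_pM2r mu1); lra.
pose B := \bigcap_(i in [set: 'I_n]) [set w | X i w <= r].
have mB : measurable B.
  apply: fin_bigcap_measurable; first exact: finite_finset.
  by move=> i _; apply: measurable_set_le; exact: measurable_RV.
pose Er := E `&` B.
have mEr : measurable Er by exact: measurableI.
have N0 := Pr_some_negative X_F F_ge0.
have mN := measurable_some_negative X.
have EEr : Pr P E <= Pr P Er + n%:R * tail F r.
  apply: (@le_trans _ _ (Pr P Er + Pr P (~` B))).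
    apply: (@Pr_leU _ _ _ _ (some_negative X)) => //; first exact: measurableC.
    by move=> w _ Ew; have [Bw|Bw] := pselect (B w); [left|right].
  rewrite lerD2l mulr_natl.
  have -> : tail F r *+ n = \sum_(i < n) Pr P [set w | X i w > r].
    by rewrite (eq_bigr (fun=> tail F r)) ?sumr_const ?card_ord// => i _; exact: Pr_RV_gt.
  apply: (@Pr_le_sum _ _ _ _ _ (some_negative X)) => //.
  - exact: measurableC.
  - by move=> i; apply: measurable_set_gt; exact: measurable_RV.
  move=> w _ /existsNP[i /not_implyP[_ /negP]]; rewrite -ltNge => ri.
  by exists i.
apply: (le_trans EEr); apply: lerD => //.
have step : expR (- (s * (n%:R * (mu - eps)))) * Pr P Er <= M * (1 - kap * nu) ^+ n.
  pose c (o : option 'I_K) : R := if o is Some _ then kap * D else 1 - kap * L.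
  pose t (o : option 'I_K) : R := if o is Some k then k.+1%:R * D else r.
  have c0 o : 0 <= c o.
    by case: o => [k|]/=; [rewrite mulr_ge0// ltW|rewrite subr_ge0].
  have sumE : \sum_o c o * (1 - tail F (t o)) <= 1 - kap * nu.
    rewrite big_option_sum/=.
    under eq_bigr do rewrite mulrBr mulr1.
    rewrite sumrB sumr_const card_ord -mulr_natl.
    rewrite (_ : \sum_(i < K) kap * D * tail F (i.+1%:R * D) = kap * nu); last first.
      by rewrite /nu mulr_sumr; apply: eq_bigr => k _; rewrite mulrA.
    have -> : K%:R * (kap * D) = kap * L by rewrite LE; ring.
    have : 0 <= (1 - kap * L) * tail F r by rewrite mulr_ge0 ?tail_ge0// subr_ge0.
    by lra.
  apply: (@le_trans _ _ (M * (\sum_o c o * (1 - tail F (t o))) ^+ n)); last first.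
    rewrite ler_pM2l// lerXn2r ?nnegrE//.
      by apply: sumr_ge0 => o _; rewrite mulr_ge0// subr_ge0 tail_le1.
    apply: le_trans sumE; apply: sumr_ge0 => o _.
    by rewrite mulr_ge0// subr_ge0 tail_le1.
  apply: (ENOD_le_step X_F F_ge0 X_ENOD) => //.
  move=> w Nw [Ew Bw].
  pose S i := \sum_(k < K) D * (k.+1%:R * D < X i w)%R%:R.
  have S_ge0 i : 0 <= S i.
    by apply: sumr_ge0 => k _; rewrite mulr_ge0// ltW.
  have SL i : S i <= Num.min (X i w) L.
    by rewrite LE; apply: grid_le => //; exact: (not_some_negative i Nw).
  apply: (@le_trans _ _ (\prod_(i < n) expR (- (s * S i)))).
    rewrite -expR_sum ler_expR sumrN lerN2 -mulr_sumr ler_wpM2l ?(ltW s0)//.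
    by apply: le_trans Ew; apply: ler_sum => i _.
  apply: ler_prod => i _; rewrite expR_ge0/=.
  have sS0 : 0 <= s * S i by rewrite mulr_ge0// ltW.
  apply: (le_trans (expRN_le_quadratic sS0)).
  apply: (@le_trans _ _ (1 - kap * S i)).
    rewrite /kap; have : 0 <= s ^+ 2 * (S i * (L - S i)).
      rewrite mulr_ge0 ?exprn_ge0 ?(ltW s0)// mulr_ge0// subr_ge0.
      by apply: le_trans (SL i) _; rewrite ge_min lexx orbT.
    by lra.
  rewrite big_option_sum/= (Bw i I) mulr1.
  rewrite /S mulr_sumr -addrA lerD2l LE.
  have -> : - (kap * (K%:R * D)) = - \sum_(k < K) kap * D.
    by rewrite sumr_const card_ord -mulr_natl; ring.
  rewrite addrC -sumrB -sumrN; apply: ler_sum => k _.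
  by rewrite ltNge; case: (X i w <= _) => /=; rewrite ?mulr1n ?mulr0n; lra.
rewrite -(ler_pM2l (expR_gt0 (- (s * (n%:R * (mu - eps)))))).
apply: (le_trans step); rewrite mulrCA ler_pM2l// -expRD.
have nuB : 1 - kap * nu <= expR (- (kap * nu)) by exact: expR_ge1Dx.
have nu0 : 0 <= 1 - kap * nu.
  have : nu <= L.
    rewrite /nu LE; apply: (@le_trans _ _ (\sum_(k < K) D)).
      by apply: ler_sum => k _; rewrite ler_piMr ?tail_le1// ltW.
    by rewrite sumr_const card_ord mulr_natl.
  by move=> /(ler_wpM2l kap_ge0); lra.
apply: (@le_trans _ _ (expR (- (kap * nu)) ^+ n)).
  by rewrite lerXn2r ?nnegrE ?expR_ge0.
rewrite -expRM_natr ler_expR.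
have : kap * (mu - eps / 2) <= kap * nu by rewrite ler_wpM2l// ltW.
have : s * (s * (L * mu)) <= s * (eps / 4) by rewrite ler_pM2l.
have : 0 <= s ^+ 2 * (L * eps) by rewrite mulr_ge0 ?exprn_ge0 ?(ltW s0)// mulr_ge0// ltW.
move=> h1 h2 h3.
have : s * eps / 4 + s * (mu - eps) <= kap * nu.
  by apply: le_trans h3; rewrite /kap; lra.
have n0' : 0 <= n%:R :> R by [].
by move=> /(ler_wpM2l n0'); lra.
Qed.

End chernoff.

Section truncated_chernoff.
Context d (T : measurableType d) (R : realType) (P : probability T R).
Variables (X : nat -> {RV P >-> R}) (F : probability (measurableTypeR R) R).
Hypothesis X_F : forall i, has_distribution (X i) F.
Hypothesis F_ge0 : Pr F `[0, +oo[ = 1.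
Variables (mu M : R).
Hypothesis F_mean : mean F = mu%:E.
Hypothesis X_ENOD : ENOD X M.

(** The jumps at the grid points below [x] telescope. *)
Lemma expR_min_le_step (h D x : R) (K : nat) : 0 <= h -> 0 < D -> 0 <= x ->
  expR (h * Num.min x (K%:R * D)) <=
  1 + \sum_(k < K) (expR (h * (k.+1%:R * D)) - expR (h * (k%:R * D))) *
        (k%:R * D < x)%R%:R.
Proof.
move=> h0 D0 x0; elim: K => [|K IH].
  by rewrite big_ord0 mul0r min_r// mulr0 expR0 addr0.
rewrite big_ord_recr/=; have [lt|ge] := ltP (K%:R * D) x.
  rewrite mulr1; move: IH; rewrite min_r; last exact: ltW.
  have : expR (h * Num.min x (K.+1%:R * D)) <= expR (h * (K.+1%:R * D)).
    by rewrite ler_expR ler_wpM2l// ge_min lexx orbT.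
  by lra.
rewrite mulr0 addr0; apply: le_trans IH.
rewrite ler_expR ler_wpM2l// le_min ge_min lexx/=.
by rewrite ge_min ge.
Qed.

(** In the exponential moment, jumps of the grid below the level [s] are bounded
    by the derivative [h * expR (h * (s + D))] and give the mean, while those
    above [s] telescope and carry the weight [tail F s]. *)
Lemma grid_chernoff (h D s y : R) (K n : nat) : 0 <= h -> 0 < D ->
  (0 < K)%N -> (0 < n)%N ->
  Pr P [set w | y < \sum_(i < n) Num.min (X i w) (K%:R * D)] <=
  M * expR (n%:R * (h * expR (h * (s + D)) * (mu + D)
                    + expR (h * (K%:R * D)) * tail F s) - h * y).
Proof.
move=> h0 D0 K0 n0; set E := [set w | _ < _].
have mE : measurable E by apply: measurable_set_gt; exact: measurable_sum_minRV.
have M0 := ENOD_coef_gt0 X_ENOD.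
set e := (X in M * expR (n%:R * X - _)).
pose de k := expR (h * (k.+1%:R * D)) - expR (h * (k%:R * D)).
have de0 k : 0 <= de k.
  by rewrite subr_ge0 ler_expR ler_wpM2l// ler_pM2r// ler_nat.
pose c (o : option 'I_K) : R := if o is Some k then de k else 1.
pose t (o : option 'I_K) : R := if o is Some k then k%:R * D else -1.
have c0 o : 0 <= c o by case: o => [k|]//=.
have step : expR (h * y) * Pr P E <= M * (\sum_o c o * tail F (t o)) ^+ n.
  apply: (ENOD_gt_step X_F F_ge0 X_ENOD) => //.
  move=> w Nw /ltW Ew.
  apply: (@le_trans _ _ (\prod_(i < n) expR (h * Num.min (X i w) (K%:R * D)))).
    by rewrite -expR_sum ler_expR -mulr_sumr ler_wpM2l.
  apply: ler_prod => i _; rewrite expR_ge0/=.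
  have Xi := not_some_negative i Nw.
  apply: (le_trans (expR_min_le_step K h0 D0 Xi)).
  by rewrite big_option_sum/= mul1r (lt_le_trans _ Xi)// ltrN10.
have sumE : \sum_o c o * tail F (t o) <= 1 + e.
  rewrite big_option_sum/= mul1r tail_lt0 ?ltrN10// lerD2l.
  apply: (@le_trans _ _ (\sum_(k < K) (h * expR (h * (s + D)) * (D * tail F (k%:R * D))
      + de k * tail F s))).
    apply: ler_sum => k _.
    have [ks|ks] := leP (k%:R * D) s; last first.
      apply: (@le_trans _ _ (de k * tail F s)).
        by rewrite ler_wpM2l// tail_nonincreasing// ltW.
      by rewrite lerDr !mulr_ge0 ?expR_ge0 ?tail_ge0// ltW.
    apply: (@le_trans _ _ (h * expR (h * (s + D)) * (D * tail F (k%:R * D)))); last first.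
      by rewrite lerDl mulr_ge0// tail_ge0.
    rewrite mulrA ler_wpM2r ?tail_ge0//.
    have -> : de k = expR (h * (k.+1%:R * D)) * (1 - expR (- (h * D))).
      rewrite mulrBr mulr1 -expRD; congr (_ - expR _).
      by rewrite -[k.+1]addn1 natrD; ring.
    have h1 : 1 - expR (- (h * D)) <= h * D.
      by have := expR_ge1Dx (- (h * D)); lra.
    apply: (@le_trans _ _ (expR (h * (k.+1%:R * D)) * (h * D))).
      by rewrite ler_wpM2l// expR_ge0.
    rewrite mulrA ler_wpM2r ?(ltW D0)// mulrC ler_wpM2l//.
    rewrite ler_expR ler_wpM2l// -[k.+1]addn1 natrD mulrDl mul1r lerD2r//.
  rewrite big_split/= -mulr_sumr -mulr_suml /e lerD//.
    rewrite ler_wpM2l ?mulr_ge0 ?expR_ge0//.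
    case: (K) K0 => // K' _; rewrite big_ord_recl/= mul0r addrC lerD//.
      by have := sum_tail_le_mean F_ge0 F_mean K' D0.
    by rewrite ler_piMr ?tail_le1// ltW.
  rewrite ler_wpM2r ?tail_ge0//.
  rewrite -(big_mkord xpredT de) /de telescope_sumr//.
  by rewrite lerBlDr lerDl expR_ge0.
have sum0 : 0 <= \sum_o c o * tail F (t o).
  by apply: sumr_ge0 => o _; rewrite mulr_ge0// tail_ge0.
rewrite -(ler_pM2l (expR_gt0 (h * y))); apply: (le_trans step).
rewrite mulrCA ler_pM2l// -expRD addrC subrK.
apply: (@le_trans _ _ (expR e ^+ n)); last by rewrite -expRM_natr mulrC.
rewrite lerXn2r ?nnegrE ?expR_ge0//.
by apply: (le_trans sumE); exact: expR_ge1Dx.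
Qed.

Variable G : probability (measurableTypeR R) R.
Variable muG : R.
Hypothesis G_ge0 : Pr G `[0, +oo[ = 1.
Hypothesis G_mean : mean G = muG%:E.
Hypothesis G_C : consistently_varying G.
Variable Kc : R.
Hypothesis F_G : forall x, tail F x <= Kc * tail G x.

(** With [q = n * tail G m] for [m = rho * x] and [a = - ln q], the parameter
    [h = a / (4 * m)] makes [expR (h * 16 * m)] equal to [q ^ (- 4)]. Truncation
    at [m] keeps the exponential moment under control: splitting the tail at
    [s = m / a ^ 2], the part below [s] behaves like the mean since
    [h * s = 1 / (4 * a)], and by the polynomial decay of the tail the part
    above [s] is at most a power of [a] times [expR (- a / 2)], hence bounded.
    What remains is of order [q ^ 3], where [q <= 1]. Only an upper bound of the tail by a
    consistently varying one enters, so that the inter-arrival times are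
    covered as well as the claims. *)
Lemma truncated_chernoff rho gamma : 0 < rho -> 0 < gamma ->
  exists C x1, 0 < C /\ 0 < x1 /\ forall n x, (0 < n)%N -> x1 <= x ->
    gamma * n%:R <= x ->
    Pr P [set w | n%:R * mu + 16 * rho * x <
                  \sum_(i < n) Num.min (X i w) (rho * x)]
      <= C * (n%:R * tail G (rho * x)) ^+ 2.
Proof.
move=> rho0 gam0; have mu0 := mean_ge0 F_ge0 F_mean.
have M0 := ENOD_coef_gt0 X_ENOD.
have [C [p [C1 pot]]] := potter G_C.
have G1 : 0 < tail G 1 by exact: tail_gt0.
have Kc0 : 0 <= Kc.
  have := F_G 1; have := tail_ge0 F 1.
  by move=> h1 /(le_trans h1); rewrite pmulr_lge0.
pose D := 4 * rho * gamma.
have D0 : 0 < D by rewrite !mulr_gt0.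
pose B := (2 * (2 * p.+1).+1%:R) ^+ (2 * p.+1) : R.
have B0 : 0 < B by rewrite exprn_gt0// mulr_gt0.
pose B1 := (2 * (2 * p).+1%:R) ^+ (2 * p) : R.
have B10 : 0 < B1 by rewrite exprn_gt0// mulr_gt0.
pose E1 := Kc * C * B1 + (mu + D) / D.
have [m0 [m00 m0H]] := mul_tail_to0 G_ge0 G_mean
  (mulr_gt0 (mulr_gt0 rho0 gam0) (expR_gt0 (-1))).
pose m1 := 1 + m0 + B * (C / tail G 1) * D ^+ p.+1.
have m10 : 0 < m1.
  rewrite /m1; have : 0 < B * (C / tail G 1) * D ^+ p.+1.
    by rewrite !mulr_gt0 ?invr_gt0 ?exprn_gt0//; lra.
  by lra.
exists (M * expR E1), (m1 / rho); split; first by rewrite mulr_gt0 ?expR_gt0.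
split; first by rewrite divr_gt0.
move=> n x n0 x1x gx.
have nr0 : 0 < n%:R :> R by rewrite ltr0n.
have x0 : 0 < x by apply: lt_le_trans x1x; rewrite divr_gt0.
set m := rho * x.
have mm1 : m1 <= m by move: x1x; rewrite ler_pdivrMr// mulrC.
have mpos : 0 < m by lra.
have nm : n%:R * (rho * gamma) <= m by rewrite /m; nra.
set q := n%:R * tail G m.
have Gm0 : 0 < tail G m by exact: tail_gt0.
have q0 : 0 < q by rewrite mulr_gt0.
have Bpos : 0 < B * (C / tail G 1) * D ^+ p.+1.
  by rewrite !mulr_gt0 ?invr_gt0 ?exprn_gt0//; lra.
have q1 : q <= expR (-1).
  have := m0H m; have h : m0 <= m by rewrite /m1 in mm1; lra.
  move=> /(_ h) => h1.
  have rg : 0 < rho * gamma by rewrite mulr_gt0.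
  rewrite -(ler_pM2l rg); apply: le_trans h1.
  by rewrite /q mulrA ler_wpM2r ?(ltW Gm0)// mulrC.
pose a := - ln q.
have ea : expR (- a) = q by rewrite /a opprK lnK// posrE.
have a1 : 1 <= a by move: q1; rewrite -ea ler_expR; lra.
clearbody a.
have a0 : 0 < a by lra.
(* the grid is finer than the splitting point of the tail *)
have Da : D * a ^+ 2 <= m.
  rewrite leNgt; apply/negP => mDa.
  have qpot : expR a <= C / tail G 1 * m ^+ p.
    have m_ge1 : 1 <= m by rewrite /m1 in mm1; lra.
    have := pot 1 m m_ge1; rewrite mulr1 => h.
    have -> : expR a = q^-1 by rewrite -ea expRN invrK.
    rewrite -[leLHS]mul1r ler_pdivrMr//.
    apply: (@le_trans _ _ (C / tail G 1 * m ^+ p * tail G m)).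
      rewrite (_ : _ * tail G m = C * m ^+ p * tail G m / tail G 1); last by ring.
      by rewrite ler_pdivlMr// mul1r.
    rewrite ler_wpM2l//; first by rewrite mulr_ge0 ?divr_ge0 ?exprn_ge0//; lra.
    by rewrite /q ler_peMl ?(ltW Gm0)// ler1n.
  have h1 : a ^+ (2 * p.+1) <= B * expR (a / 2) by apply: pow_le_expR; exact: ltW.
  have h2 : expR (a / 2) <= expR a by rewrite ler_expR; lra.
  have h3 : (m / D) ^+ p.+1 <= a ^+ (2 * p.+1).
    rewrite exprM lerXn2r ?nnegrE ?divr_ge0 ?exprn_ge0 ?(ltW D0) ?(ltW a0) ?(ltW mpos)//.
    by rewrite ler_pdivrMr// mulrC ltW.
  have h4 : (m / D) ^+ p.+1 <= B * (C / tail G 1 * m ^+ p).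
    by rewrite (le_trans h3)// (le_trans h1)// ler_pM2l// (le_trans h2).
  move: h4; rewrite expr_div_n ler_pdivrMr ?exprn_gt0// exprS.
  rewrite (_ : B * _ * _ = B * (C / tail G 1) * D ^+ p.+1 * m ^+ p); last by ring.
  rewrite ler_pM2r ?exprn_gt0//; rewrite /m1 in mm1; lra.
have Dm : D <= m.
  apply: le_trans Da; rewrite ler_peMr ?(ltW D0)// exprn_ege1//.
pose K := (Num.truncn (m / D)).+1.
have mK : m <= K%:R * D by rewrite -ler_pdivrMr// ltW// truncnS_gt.
have Km : K%:R * D <= 2 * m.
  rewrite /K -[_.+1]addn1 natrD mulrDl mul1r.
  have : (Num.truncn (m / D))%:R * D <= m.
    by rewrite -ler_pdivlMr// truncn_le divr_ge0// ltW.
  by lra.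
pose h := a / (4 * m).
have m40 : 0 < 4 * m by lra.
have h0 : 0 < h by rewrite divr_gt0.
have hm : h * m = a / 4 by rewrite /h; field; rewrite gt_eqF.
pose s := m / a ^+ 2.
have Ds : D <= s by rewrite ler_pdivlMr// exprn_gt0.
have s0 : 0 < s by lra.
have hs : h * s = (4 * a)^-1.
  by rewrite /h /s; field; rewrite !gt_eqF.
have sm : a ^+ 2 * s = m by rewrite /s mulrC divfK// gt_eqF// exprn_gt0.
apply: (@le_trans _ _ (Pr P [set w | n%:R * mu + 16 * m <
      \sum_(i < n) Num.min (X i w) (K%:R * D)])).
  apply: (@Pr_le _ _ _ _ set0) => //.
  - by apply: measurable_set_gt; exact: measurable_sum_minRV.
  - by apply: measurable_set_gt; exact: measurable_sum_minRV.
  - by rewrite /Pr measure0.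
  move=> w _ /=; rewrite -mulrA => /lt_le_trans; apply; apply: ler_sum => i _.
  by rewrite le_min !ge_min lexx/= mK orbT.
apply: (le_trans (grid_chernoff s _ (ltW h0) D0 _ n0)) => //.
rewrite -[leRHS]mulrA ler_pM2l//.
have -> : q ^+ 2 = expR (- (2 * a)).
  by rewrite -ea -expRM_natr; congr expR; ring.
rewrite -expRD ler_expR.
have tFs : n%:R * (expR (h * (K%:R * D)) * tail F s) <= Kc * C * B1.
  have e1 : expR (h * (K%:R * D)) <= expR (a / 2).
    rewrite ler_expR; apply: (@le_trans _ _ (h * (2 * m))).
      by rewrite ler_pM2l.
    by lra.
  have e2 : tail F s <= Kc * (C * a ^+ (2 * p) * tail G m).
    apply: (le_trans (F_G s)); rewrite ler_wpM2l//.
    have := pot s (a ^+ 2); rewrite sm -exprM; apply.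
    exact: exprn_ege1.
  apply: (@le_trans _ _ (n%:R * (expR (a / 2) * (Kc * (C * a ^+ (2 * p) * tail G m))))).
    by rewrite ler_pM2l//; apply: ler_pM; rewrite ?expR_ge0 ?tail_ge0.
  rewrite (_ : n%:R * _ = Kc * C * (expR (a / 2) * q * a ^+ (2 * p))); last by rewrite /q; ring.
  rewrite ler_wpM2l ?mulr_ge0//; first by lra.
  have -> : expR (a / 2) * q = (expR (a / 2))^-1.
    by rewrite -ea -expRN -expRD; congr expR; field.
  rewrite mulrC ler_pdivrMr ?expR_gt0//.
  by apply: pow_le_expR; exact: ltW.
have ehs : expR (h * (s + D)) <= 1 + a^-1.
  apply: (@le_trans _ _ (expR (1 / (2 * a)))).
    rewrite ler_expR; apply: (@le_trans _ _ (2 * (h * s))).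
      have : h * D <= h * s by rewrite ler_pM2l.
      by lra.
    by rewrite hs; apply: eq_ler; field; rewrite gt_eqF.
  apply: (le_trans (expR_le_affine _ _)).
  - by rewrite divr_ge0//; lra.
  - by rewrite ler_pdivrMr; lra.
  - by rewrite lerD2l; apply: eq_ler; field; rewrite gt_eqF.
have muD0 : 0 <= n%:R * h * (mu + D) 
  by apply: mulr_ge0; [rewrite mulr_ge0// ltW|rewrite addr_ge0// ltW].
have ha : h * a^-1 * m = 4^-1 by rewrite mulrAC hm; field; rewrite gt_eqF.
have nD : n%:R * D <= 4 * m by rewrite /D; nra.
have main : n%:R * (h * expR (h * (s + D)) * (mu + D)) <=
    n%:R * h * mu + a + (mu + D) / D.
  apply: (@le_trans _ _ (n%:R * h * (mu + D) * (1 + a^-1))).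
    by rewrite (_ : n%:R * _ = n%:R * h * (mu + D) * expR (h * (s + D))); [rewrite ler_wpM2l|ring].
  have hi : 0 <= h * a^-1 by rewrite mulr_ge0// ltW// invr_gt0.
  have i1 : n%:R * D * h <= a.
    by apply: (@le_trans _ _ (4 * m * h)); [rewrite ler_pM2r|lra].
  have i2 : n%:R * h * a^-1 * (mu + D) <= (mu + D) / D.
    rewrite mulrC ler_wpM2l//; first lra.
    rewrite -[leRHS]mul1r ler_pdivlMr//.
    rewrite (_ : n%:R * h / a * D = n%:R * D * (h * a^-1)); last by ring.
    apply: (@le_trans _ _ (4 * m * (h * a^-1))); first by rewrite ler_wpM2r.
    by lra.
  by lra.
rewrite mulrDr /E1; lra.
Qed.

End truncated_chernoff.

(** * Precise large deviations of claim sums *)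

Section large_deviations.
Context d (T : measurableType d) (R : realType) (P : probability T R).
Variables (Y : nat -> {RV P >-> R}) (G : probability (measurableTypeR R) R).
Hypothesis Y_G : forall i, has_distribution (Y i) G.
Hypothesis G_ge0 : Pr G `[0, +oo[ = 1.
Variables (mu M : R).
Hypothesis G_mean : mean G = mu%:E.
Hypothesis G_C : consistently_varying G.
Hypothesis Y_ENOD : ENOD Y M.

(** If at most one term exceeds [l], truncating the terms at [l] removes at
    most [u - l] from the sum. *)
Lemma sum_gt_cases (n : nat) (y : 'I_n -> R) (l u : R) :
  l <= u -> (forall i, y i <= u) -> (forall i j, i != j -> l < y i -> y j <= l) ->
  0 <= u -> 0 <= l ->
  \sum_i y i <= \sum_i Num.min (y i) l + (u - l).
Proof.
move=> lu yu pair u0 l0.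
have [[i li]|nol] := pselect (exists i, l < y i); last first.
  rewrite -[leLHS]addr0 lerD ?subr_ge0//; apply: ler_sum => i _.
  by rewrite le_min lexx/= leNgt; apply/negP => h; apply: nol; exists i.
rewrite (bigD1 i)//= [in leRHS](bigD1 i)//= (min_r (ltW li)).
have : \sum_(j | j != i) y j <= \sum_(j | j != i) Num.min (y j) l.
  apply: ler_sum => j ji; rewrite le_min lexx/=.
  by apply: (pair i j) => //; rewrite eq_sym.
by have := yu i; lra.
Qed.

(** A large sum has one term above [(1 - 16 * rho) * x], or two terms above
    [rho * x], or a large truncated sum. The first possibility has the claimed
    probability; the other two have probabilities of order
    [(n * tail G (rho * x)) ^ 2], negligible because [x * tail G x] tends
    to zero. *)
Lemma large_deviation_le eps gamma : 0 < eps -> 0 < gamma ->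
  exists x0, 0 < x0 /\ forall n x, (0 < n)%N -> x0 <= x -> gamma * n%:R <= x ->
    Pr P [set w | n%:R * mu + x < \sum_(i < n) Y i w]
      <= (1 + eps) * (n%:R * tail G x).
Proof.
move=> e0 g0; have M0 := ENOD_coef_gt0 Y_ENOD.
have e2 : 0 < eps / (2 + eps) by rewrite divr_gt0//; lra.
have [eta [x1 [/andP[eta0 eta1] [x11 cv]]]] := consistent_variation G_C e2.
(* chosen so that (1 + eta) * (1 - 16 * rho) = 1 *)
pose rho := eta / (1 + eta) / 16.
have rho0 : 0 < rho by rewrite !divr_gt0//; lra.
have rhoE : (1 + eta) * (1 - 16 * rho) = 1.
  by rewrite /rho; field; rewrite gt_eqF//; lra.
have rho1 : 0 < 1 - 16 * rho.
  have e1 : 0 < 1 + eta by lra.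
  by rewrite -(ltr_pM2l e1) mulr0 rhoE.
clearbody rho.
have [C' [C'0 scale]] := tail_scale G_C rho0.
have KG x : tail G x <= 1 * tail G x by rewrite mul1r.
have [C [x2 [C0 [x20 tc]]]] :=
  truncated_chernoff Y_G G_ge0 G_mean Y_ENOD G_ge0 G_mean G_C KG rho0 g0.
pose del := eps / 2 / ((M + C) * C') * (rho * gamma).
have MC0 : 0 < M + C by lra.
have del0 : 0 < del by rewrite !mulr_gt0 ?invr_gt0 ?mulr_gt0.
have [x3 [x30 small]] := mul_tail_to0 G_ge0 G_mean del0.
exists (x1 / (1 - 16 * rho) + x2 + x3 / rho).
have q1 : 0 < x1 / (1 - 16 * rho) by rewrite divr_gt0//; lra.
have q3 : 0 < x3 / rho by rewrite divr_gt0.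
split; first lra.
move=> n x n0 xx gx.
have x0 : 0 < x by lra.
have nr0 : 0 < n%:R :> R by rewrite ltr0n.
have rx0 : 0 < rho * x by rewrite mulr_gt0.
set u := (1 - 16 * rho) * x.
have u0 : 0 < u by rewrite mulr_gt0.
have lu : rho * x <= u.
  have e1 : 0 < 1 + eta by lra.
  by rewrite /u ler_pM2r// -(ler_pM2l e1); lra.
pose A1 (i : 'I_n) := [set w | u < Y i w].
pose A2 (p : 'I_n * 'I_n) := if p.1 == p.2 then set0 else
  [set w | rho * x < Y p.1 w] `&` [set w | rho * x < Y p.2 w].
pose A3 := [set w | n%:R * mu + 16 * rho * x < \sum_(i < n) Num.min (Y i w) (rho * x)].
have mA1 i : measurable (A1 i) by apply: measurable_set_gt; exact: measurable_RV.
have mA2 p : measurable (A2 p).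
  by rewrite /A2; case: ifP => // _; apply: measurableI;
    apply: measurable_set_gt; exact: measurable_RV.
have mA3 : measurable A3 by apply: measurable_set_gt; exact: measurable_sum_minRV.
have mB1 : measurable (\bigcup_(i in [set: 'I_n]) A1 i).
  by apply: fin_bigcup_measurable => //; exact: finite_finset.
have mB2 : measurable (\bigcup_(p in [set: 'I_n * 'I_n]) A2 p).
  by apply: fin_bigcup_measurable => //; exact: finite_finset.
have mS : measurable [set w | n%:R * mu + x < \sum_(i < n) Y i w].
  by apply: measurable_set_gt; exact: measurable_sum_RV.
have N0 := Pr_some_negative Y_G G_ge0.
have mN := measurable_some_negative Y.
have PA1 : Pr P (\bigcup_(i in [set: 'I_n]) A1 i) <= n%:R * tail G u.
  apply: (@le_trans _ _ (\sum_i Pr P (A1 i))).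
    by apply: (@Pr_le_sum _ _ _ _ _ (some_negative Y)) => // w _ [i _ Ai]; exists i.
  rewrite (eq_bigr (fun=> tail G u)) ?sumr_const ?card_ord ?mulr_natl//.
  by move=> i _; exact: Pr_RV_gt.
have PA2 : Pr P (\bigcup_(p in [set: 'I_n * 'I_n]) A2 p) <=
    M * (n%:R * tail G (rho * x)) ^+ 2.
  apply: (@le_trans _ _ (\sum_p Pr P (A2 p))).
    by apply: (@Pr_le_sum _ _ _ _ _ (some_negative Y)) => // w _ [i _ Ai]; exists i.
  apply: (@le_trans _ _ (\sum_(p : 'I_n * 'I_n) M * tail G (rho * x) ^+ 2)).
    apply: ler_sum => -[i j] _; rewrite /A2/=; case: ifPn => [_|ij].
      by rewrite /Pr measure0 mulr_ge0 ?exprn_ge0 ?tail_ge0// ltW.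
    exact: (ENOD_pair Y_G G_ge0 Y_ENOD).
  rewrite sumr_const card_prod card_ord -[leLHS]mulr_natl natrM exprMn.
  by apply: eq_ler; ring.
have PA3 : Pr P A3 <= C * (n%:R * tail G (rho * x)) ^+ 2 by apply: tc => //; lra.
have union : Pr P [set w | n%:R * mu + x < \sum_(i < n) Y i w] <=
    n%:R * tail G u + (M + C) * (n%:R * tail G (rho * x)) ^+ 2.
  apply: (@le_trans _ _ (Pr P (\bigcup_(i in [set: 'I_n]) A1 i) +
     Pr P ((\bigcup_(p in [set: 'I_n * 'I_n]) A2 p) `|` A3))).
    apply: (@Pr_leU _ _ _ _ (some_negative Y)) => //; first exact: measurableU.
    move=> w Nw Sw; have [|nA1] := pselect ((\bigcup_(i in [set: 'I_n]) A1 i) w).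
      by left.
    right; have [|nA2] := pselect ((\bigcup_(p in [set: 'I_n * 'I_n]) A2 p) w).
      by left.
    right; rewrite /A3/=.
    have := @sum_gt_cases n (fun i => Y i w) (rho * x) u lu.
    move=> /(_ _ _ (ltW u0) (ltW rx0)) h.
    have : \sum_(i < n) Y i w <=
        \sum_(i < n) Num.min (Y i w) (rho * x) + (u - rho * x).
      apply: h.
        by move=> i; rewrite leNgt; apply/negP => ui; apply: nA1; exists i.
      move=> i j ij ri; rewrite leNgt; apply/negP => rj; apply: nA2.
      by exists (i, j) => //; rewrite /A2/= (negPf ij).
    by move: Sw => /=; rewrite /u; lra.
  have : Pr P ((\bigcup_(p in [set: 'I_n * 'I_n]) A2 p) `|` A3) <=
      Pr P (\bigcup_(p in [set: 'I_n * 'I_n]) A2 p) + Pr P A3.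
    by apply: (@Pr_leU _ _ _ _ (some_negative Y)) => //; exact: measurableU.
  by lra.
apply: (le_trans union).
have cvu : tail G u <= (1 + eps / 2) * tail G x.
  have := cv u x; rewrite /u mulrA rhoE mul1r => /(_ _ (lexx _)) h.
  have : (1 - eps / (2 + eps)) * tail G ((1 - 16 * rho) * x) <= tail G x.
    by apply: h; rewrite -ler_pdivrMl//; rewrite mulrC; lra.
  have -> : 1 - eps / (2 + eps) = 2 / (2 + eps).
    by field; rewrite gt_eqF//; lra.
  rewrite mulrAC ler_pdivrMr; last by lra.
  by rewrite -/u; lra.
have quad : (M + C) * (n%:R * tail G (rho * x)) ^+ 2 <= eps / 2 * (n%:R * tail G x).
  have sc := scale x (ltW x0).
  have sm : rho * x * tail G (rho * x) <= del.
    apply: small; rewrite mulrC -ler_pdivrMr//; lra.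
  have sm2 : n%:R * tail G (rho * x) <= eps / 2 / ((M + C) * C').
    have rg : 0 < rho * gamma by rewrite mulr_gt0.
    rewrite -(ler_pM2r rg); apply: le_trans sm.
    rewrite [leRHS]mulrC (_ : n%:R * _ * _ = tail G (rho * x) * (rho * (gamma * n%:R))); last by ring.
    by rewrite ler_wpM2l ?tail_ge0// ler_pM2l.
  rewrite expr2 mulrA.
  apply: (@le_trans _ _ ((M + C) * (eps / 2 / ((M + C) * C')) * (n%:R * (C' * tail G x)))).
    have t0 := tail_ge0 G (rho * x).
    apply: ler_pM => //; rewrite ?mulr_ge0//; rewrite ?ler_pM2l//; lra.
  by apply: eq_ler; field; rewrite !gt_eqF.
have : n%:R * tail G u <= n%:R * ((1 + eps / 2) * tail G x) by rewrite ler_pM2l.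
by lra.
Qed.

(** One large term suffices as long as the sum of the truncated terms is not
    far below its mean, and the latter fails with exponentially small
    probability. Orthant bounds give no joint control of one large term and
    small other ones. Instead, nonnegativity makes the truncated sum exceed
    [n * mu - eta / 4 * x] trivially unless [x] is of order [n], and then an
    exponential is negligible against [n * tail G x]. *)
Lemma large_deviation_ge eps gamma : 0 < eps -> 0 < gamma ->
  exists n0 : nat, (0 < n0)%N /\ forall n x, (n0 <= n)%N -> gamma * n%:R <= x ->
    (1 - eps) * (n%:R * tail G x) <=
    Pr P [set w | n%:R * mu + x < \sum_(i < n) Y i w].
Proof.
move=> e0 g0; have M0 := ENOD_coef_gt0 Y_ENOD.
have mu0 := mean_ge0 G_ge0 G_mean.
have e4 : 0 < eps / 4 by lra.
have [eta [x1 [/andP[eta0 eta1] [x11 cv]]]] := consistent_variation G_C e4.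
have ge0 : 0 < eta * gamma / 4 by rewrite !mulr_gt0// invr_gt0.
have [L [c [L0 [c0 lc]]]] := lower_chernoff Y_G G_ge0 G_mean Y_ENOD ge0.
have A0 : 0 < 4 * mu / eta + 1 by have : 0 <= 4 * mu / eta; [rewrite divr_ge0// ?mulr_ge0// ltW|lra].
have eM : 0 < eps / 4 / M by rewrite divr_gt0.
have [n1 [n10 ex]] := expR_le_tail G_C c0 A0 eM.
have [x2 [x20 small]] := mul_tail_to0 G_ge0 G_mean (mulr_gt0 e4 (divr_gt0 g0 M0)).
pose X0 := x1 + 4 * L / eta + x2.
have Le0 : 0 <= 4 * L / eta by rewrite divr_ge0 ?mulr_ge0// ltW.
exists (n1 + (Num.truncn (X0 / gamma)).+1)%N; split; first by rewrite addnS.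
move=> n x n01 gx.
have n0 : (0 < n)%N by apply: leq_trans n01; rewrite addnS.
have nr0 : 0 < n%:R :> R by rewrite ltr0n.
have xX0 : X0 <= x.
  apply: le_trans gx; rewrite mulrC -ler_pdivrMr//.
  by apply/ltW/(lt_le_trans (truncnS_gt _)); rewrite ler_nat (leq_trans _ n01)// leq_addl.
have x0 : 0 < x by rewrite /X0 in xX0; lra.
pose v := (1 + eta / 4) * x + L.
have vx : x <= v by rewrite /v; have : 0 <= eta / 4 * x; [rewrite mulr_ge0// ?ltW// divr_gt0|lra].
have ve : v <= (1 + eta) * x.
  have : L <= eta / 4 * x.
    by rewrite mulrAC -ler_pdivrMr// -ler_pdivrMl//; move: xX0; rewrite /X0 invrK; lra.
  have : 0 <= eta * x by rewrite mulr_ge0// ltW.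
  by rewrite /v; lra.
pose A (i : 'I_n) := [set w | v < Y i w].
have mA i : measurable (A i) by apply: measurable_set_gt; exact: measurable_RV.
set S := [set w | _ < _].
have mS : measurable S by apply: measurable_set_gt; exact: measurable_sum_RV.
pose E := [set w | \sum_(i < n) Num.min (Y i w) L <= n%:R * mu - eta / 4 * x].
have mE : measurable E by apply: measurable_set_le; exact: measurable_sum_minRV.
have N0 := Pr_some_negative Y_G G_ge0.
have mN := measurable_some_negative Y.
have bonf := @Pr_bonferroni _ _ _ P (some_negative Y) (S `|` E) n A
  (measurableU _ _ mS mE) mA mN N0.
have {}bonf : n%:R * tail G v <= Pr P (S `|` E) + n%:R * (n%:R * (M * tail G x ^+ 2)).
  have -> : n%:R * tail G v = \sum_i Pr P (A i).
    rewrite (eq_bigr (fun=> tail G v)) ?sumr_const ?card_ord ?mulr_natl//.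
    by move=> i _; exact: Pr_RV_gt.
  apply: (le_trans (bonf _)).
    move=> w i Nw Aw; have [Ew|/negP Ew] := pselect (E w); first by right.
    left; move: Ew; rewrite /E/= -ltNge => Ew; rewrite /S/=.
    rewrite (bigD1 i)//=; rewrite (bigD1 i)//= in Ew.
    have : \sum_(j < n | j != i) Num.min (Y j w) L <= \sum_(j < n | j != i) Y j w.
      by apply: ler_sum => j _; rewrite ge_min lexx.
    have : Num.min (Y i w) L <= L by rewrite ge_min lexx orbT.
    by move: Aw; rewrite /A/= /v; lra.
  rewrite lerD2l -[in leRHS](mulr_natl _ n).
  apply: (@le_trans _ _ (\sum_(i < n) \sum_(j < n) M * tail G x ^+ 2)).
    apply: ler_sum => i _; rewrite [leLHS]big_mkcond/=; apply: ler_sum => j _.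
    case: ifP => ji; last by rewrite mulr_ge0 ?exprn_ge0 ?tail_ge0// ltW.
    have ij : i != j by rewrite eq_sym ji.
    apply: le_trans (ENOD_pair Y_G G_ge0 Y_ENOD v ij) _.
    by rewrite ler_pM2l// lerXn2r ?nnegrE ?tail_ge0// tail_nonincreasing.
  by rewrite !sumr_const !card_ord !mulr_natl.
have SE : Pr P (S `|` E) <= Pr P S + Pr P E.
  by apply: (@Pr_leU _ _ _ _ (some_negative Y)) => //; exact: measurableU.
have PE : Pr P E <= eps / 4 * (n%:R * tail G x).
  have [xbig|xsmall] := ltP (n%:R * mu) (eta / 4 * x).
    have -> : Pr P E = 0.
      apply/eqP; rewrite eq_le Pr_ge0 andbT -N0.
      apply: (@Pr_le _ _ _ _ (some_negative Y)) => // w Nw; rewrite /E/= => Ew; exfalso.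
      have : 0 <= \sum_(i < n) Num.min (Y i w) L.
        by apply: sumr_ge0 => i _; rewrite le_min L0 (not_some_negative i Nw).
      by lra.
    by rewrite mulr_ge0 ?mulr_ge0 ?tail_ge0// ltW.
  apply: (@le_trans _ _ (M * expR (- (c * n%:R)))).
    apply: le_trans (lc n n0).
    apply: (@Pr_le _ _ _ _ (some_negative Y)) => //.
      by apply: measurable_set_le; exact: measurable_sum_minRV.
    move=> w _; rewrite /E/= => /le_trans; apply.
    rewrite mulrBr lerD2l lerN2.
    rewrite (_ : n%:R * _ = eta / 4 * (gamma * n%:R)); last by ring.
    by rewrite ler_pM2l// divr_gt0.
  have xA : x <= (4 * mu / eta + 1) * n%:R.
    rewrite mulrDl mul1r -[leLHS]addr0 lerD//.
    rewrite -(ler_pM2l (divr_gt0 eta0 (ltr0n R 4))) (le_trans xsmall)//.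
    by apply: eq_ler; field; rewrite gt_eqF.
  have := ex n x (leq_trans (leq_addr _ _) n01) xA.
  rewrite -(ler_pM2l M0) => /le_trans; apply.
  by apply: eq_ler; field; rewrite gt_eqF.
have quad : n%:R * (n%:R * (M * tail G x ^+ 2)) <= eps / 4 * (n%:R * tail G x).
  have sm : x * tail G x <= eps / 4 * (gamma / M).
    by apply: small; rewrite /X0 in xX0; lra.
  have sm' : gamma * n%:R * tail G x <= eps / 4 * (gamma / M).
    by apply: le_trans sm; rewrite ler_wpM2r ?tail_ge0.
  have sm2 : n%:R * tail G x * M <= eps / 4.
    rewrite -(ler_pM2l (divr_gt0 g0 M0)); apply: le_trans (_ : _ <= gamma * n%:R * tail G x) _.
      by apply: eq_ler; field; rewrite gt_eqF.
    by rewrite [leRHS]mulrC.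
  rewrite (_ : n%:R * _ = n%:R * tail G x * M * (n%:R * tail G x)); last by ring.
  by rewrite ler_wpM2r// mulr_ge0// tail_ge0.
have cvv : (1 - eps / 4) * tail G x <= tail G v.
  by apply: cv => //; rewrite /X0 in xX0; lra.
have : n%:R * ((1 - eps / 4) * tail G x) <= n%:R * tail G v by rewrite ler_pM2l.
have : 0 <= eps * (n%:R * tail G x) by rewrite mulr_ge0 ?mulr_ge0 ?tail_ge0// ltW.
by lra.
Qed.

End large_deviations.

(** * Sums of variables with a lighter tail *)

Section lighter_tail.
Context d (T : measurableType d) (R : realType) (P : probability T R).
Variables (X : nat -> {RV P >-> R}) (F G : probability (measurableTypeR R) R).
Hypothesis X_F : forall i, has_distribution (X i) F.
Hypothesis F_ge0 : Pr F `[0, +oo[ = 1.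
Variables (mu M : R).
Hypothesis F_mean : mean F = mu%:E.
Hypothesis X_ENOD : ENOD X M.
Variable muG : R.
Hypothesis G_ge0 : Pr G `[0, +oo[ = 1.
Hypothesis G_mean : mean G = muG%:E.
Hypothesis G_C : consistently_varying G.
Hypothesis F_oG : littleo_pinfty (tail F) (tail G).

Lemma littleo_tail eps : 0 < eps ->
  exists x0 : R, 0 < x0 /\ forall x, x0 <= x -> tail F x <= eps * tail G x.
Proof.
move=> e0; have [x0 [_ H]] := F_oG e0; exists (Num.max 1 (x0 + 1)); split.
  by rewrite lt_max ltr01.
move=> x; rewrite ge_max => /andP[_ xx0].
have := H x; rewrite !ger0_norm ?tail_ge0// => -> //.
by rewrite (lt_le_trans _ xx0)// ltrDl.
Qed.

Lemma littleo_tail_dom : exists Kc, forall x, tail F x <= Kc * tail G x.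
Proof.
have [x0 [_ H]] := littleo_tail (ltr01 : 0 < 1 :> R).
have G0 := tail_gt0 G_C x0.
exists (tail G x0)^-1 => x; rewrite mulrC ler_pdivlMr//.
have [xx0|xx0] := leP x x0.
  apply: (@le_trans _ _ (1 * tail G x0)); first by rewrite ler_wpM2r ?tail_le1// ltW.
  by rewrite mul1r tail_nonincreasing.
apply: (@le_trans _ _ (tail G x * 1)); last by rewrite mulr1.
by apply: ler_pM; rewrite ?tail_ge0 ?tail_le1//; have := H x (ltW xx0); rewrite mul1r.
Qed.

Lemma littleo_tail_scale rho eps : 0 < rho -> 0 < eps ->
  exists x0, 0 < x0 /\ forall x, x0 <= x -> tail F (rho * x) <= eps * tail G x.
Proof.
move=> r0 e0; have [C [C0 sc]] := tail_scale G_C r0.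
have [x0 [x00 H]] := littleo_tail (divr_gt0 e0 C0).
exists (x0 / rho); split; first by rewrite divr_gt0.
move=> x; rewrite ler_pdivrMr// => xx.
have xpos : 0 < x by rewrite -(pmulr_lgt0 _ r0); lra.
rewrite mulrC in xx.
apply: (le_trans (H _ xx)); rewrite mulrAC ler_pdivrMr// -mulrA ler_pM2l// [leRHS]mulrC.
by apply: sc; exact: ltW.
Qed.

Lemma Pr_some_gt n u :
  Pr P (\bigcup_(i in [set: 'I_n]) [set w | u < X i w]) <= n%:R * tail F u.
Proof.
have -> : n%:R * tail F u = \sum_(i < n) Pr P [set w | X i w > u].
  rewrite (eq_bigr (fun=> tail F u)) ?sumr_const ?card_ord ?mulr_natl// => i _.
  exact: Pr_RV_gt.
have mA i : measurable [set w | u < X i w].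
  by apply: measurable_set_gt; exact: measurable_RV.
apply: (@Pr_le_sum _ _ _ _ _ (some_negative X)) => //.
- by apply: fin_bigcup_measurable => //; exact: finite_finset.
- exact: measurable_some_negative.
- exact: Pr_some_negative.
- by move=> w _ [i _ Ai]; exists i.
Qed.

Lemma Pr_sum_gt_crude n y : (0 < n)%N ->
  Pr P [set w | y < \sum_(i < n) X i w] <= n%:R * tail F (y / n%:R).
Proof.
move=> n0; apply: le_trans (Pr_some_gt n (y / n%:R)).
apply: (@Pr_le _ _ _ _ (some_negative X)) => //.
- by apply: measurable_set_gt; exact: measurable_sum_RV.
- apply: fin_bigcup_measurable; first exact: finite_finset.
  by move=> i _; apply: measurable_set_gt; exact: measurable_RV.
- exact: measurable_some_negative.
- exact: Pr_some_negative.
move=> w _ /= yS; apply: contrapT => nA.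
move: yS; apply/negP; rewrite -leNgt.
have nr0 : n%:R != 0 :> R by rewrite pnatr_eq0 -lt0n.
apply: (@le_trans _ _ (\sum_(i < n) y / n%:R)).
  by apply: ler_sum => i _; rewrite leNgt; apply/negP => h; apply: nA; exists i.
by rewrite sumr_const card_ord -[leLHS]mulr_natr divfK.
Qed.

(** The inter-arrival times have no regularity of their own, but one of them
    being of order [n] is negligible against [n * tail G n], and otherwise the
    sum is truncated. *)
Lemma sum_exceed_mean theta eps : 0 < theta -> 0 < eps ->
  exists n0 : nat, (0 < n0)%N /\ forall n, (n0 <= n)%N ->
    Pr P [set w | n%:R * (mu + theta) < \sum_(i < n) X i w]
      <= eps * (n%:R * tail G n%:R).
Proof.
move=> th0 e0; pose rho := theta / 16.
have rho0 : 0 < rho by rewrite divr_gt0.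
have [Kc dom] := littleo_tail_dom.
have [C [x1 [C0 [x10 tc]]]] :=
  truncated_chernoff X_F F_ge0 F_mean X_ENOD G_ge0 G_mean G_C dom rho0 ltr01.
have e2 : 0 < eps / 2 by rewrite divr_gt0.
have [x2 [x20 H2]] := littleo_tail_scale rho0 e2.
have [C' [C'0 sc]] := tail_scale G_C rho0.
have [x3 [x30 H3]] := mul_tail_to0 G_ge0 G_mean (mulr_gt0 rho0 (divr_gt0 e2 (mulr_gt0 C0 C'0))).
exists (Num.truncn (x1 + x2 + x3 / rho)).+1; split=> // n nn.
have q3 : 0 < x3 / rho by rewrite divr_gt0.
have n0 : (0 < n)%N by exact: leq_trans nn.
have nr : x1 + x2 + x3 / rho <= n%:R.
  by apply/ltW/(lt_le_trans (truncnS_gt _)); rewrite ler_nat.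
have nr0 : 0 < n%:R :> R by rewrite ltr0n.
pose B := \bigcup_(i in [set: 'I_n]) [set w | rho * n%:R < X i w].
pose A := [set w | n%:R * mu + 16 * rho * n%:R < \sum_(i < n) Num.min (X i w) (rho * n%:R)].
have PB : Pr P B <= n%:R * (eps / 2 * tail G n%:R).
  apply: (le_trans (Pr_some_gt _ _)); rewrite ler_pM2l//; apply: H2; lra.
have PA : Pr P A <= C * (n%:R * tail G (rho * n%:R)) ^+ 2.
  by apply: tc => //; [lra|rewrite mul1r].
have PAB : Pr P [set w | n%:R * (mu + theta) < \sum_(i < n) X i w] <= Pr P B + Pr P A.
  apply: (@Pr_leU _ _ _ _ (some_negative X)) => //.
  - by apply: measurable_set_gt; exact: measurable_sum_RV.
  - apply: fin_bigcup_measurable; first exact: finite_finset.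
    by move=> i _; apply: measurable_set_gt; exact: measurable_RV.
  - by apply: measurable_set_gt; exact: measurable_sum_minRV.
  - exact: measurable_some_negative.
  - exact: Pr_some_negative.
  move=> w _ Sw; have [|nB] := pselect (B w); first by left.
  right; rewrite /A/=; have -> : \sum_(i < n) Num.min (X i w) (rho * n%:R) =
      \sum_(i < n) X i w.
    apply: eq_bigr => i _; rewrite min_l// leNgt; apply/negP => h.
    by apply: nB; exists i.
  apply: le_lt_trans Sw; apply: eq_ler.
  by rewrite /rho; field.
have quad : C * (n%:R * tail G (rho * n%:R)) ^+ 2 <= eps / 2 * (n%:R * tail G n%:R).
  have sm : rho * n%:R * tail G (rho * n%:R) <= rho * (eps / 2 / (C * C')).
    by apply: H3; rewrite mulrC -ler_pdivrMr//; lra.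
  rewrite -mulrA ler_pM2l// in sm.
  have scn := sc n%:R (ltW nr0).
  rewrite expr2; apply: (@le_trans _ _ (C * (eps / 2 / (C * C') * (n%:R * (C' * tail G n%:R))))).
    have t0 := tail_ge0 G (rho * n%:R).
    by rewrite ler_pM2l//; apply: ler_pM; rewrite ?mulr_ge0// ler_pM2l.
  by apply: eq_ler; field; rewrite !gt_eqF.
by lra.
Qed.

End lighter_tail.

(** * The claim number and the independence of claims and arrivals *)

Section claim_number_paths.
Context d (T : measurableType d) (R : realType) (P : probability T R).
Variable Z : nat -> {RV P >-> R}.
Implicit Types (t : R) (w : T).

Local Notation S n w := (\sum_(i < n) Z i w).

Let counted t n w : \bar R := (\1_[set v | S n v <= t] w)%:E.

Let counted_ge0 t n w : (0 <= counted t n w)%E.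
Proof. by rewrite lee_fin. Qed.

Let countedE t n w : counted t n w = ((S n w <= t)%R%:R)%:E.
Proof.
rewrite /counted indicE; congr (nat_of_bool _)%:R%:E.
by apply/idP/idP => [/set_mem//|?]; exact/mem_set.
Qed.

Let sum_le w m n : (forall i, 0 <= Z i w) -> (m <= n)%N -> S m w <= S n w.
Proof.
move=> Z0 /subnK <-; elim: (n - m)%N => [|k IH]; first by rewrite add0n.
by rewrite addSn big_ord_recr/= (le_trans IH)// lerDl.
Qed.

Lemma claim_number_natE t w m : (forall i, 0 <= Z i w) ->
  S m w <= t -> t < S m.+1 w -> claim_number_nat Z t w = m.
Proof.
move=> Z0 mt tm; rewrite /claim_number_nat.
suff -> : claim_number Z t w = (m%:R)%:E by rewrite /= natrK.
rewrite /claim_number; apply: (@lim_near_cst _ _ _ eventually) => //.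
exists m.+1 => // K /= mK; rewrite (big_cat_nat (n := m.+1))//=.
rewrite [X in (_ + X)%E]big_nat_cond [X in (_ + X)%E]big1 ?adde0; last first.
  move=> n /andP[/andP[mn _] _]; rewrite -/(counted t n w) countedE.
  by rewrite leNgt (lt_le_trans tm)// sum_le.
rewrite big_nat_cond (eq_bigr (fun=> 1%:E)); last first.
  move=> n /andP[/andP[_ nm] _]; rewrite -/(counted t n w) countedE.
  by rewrite (le_trans _ mt)// sum_le.
by rewrite -big_nat_cond sumEFin sumr_const_nat subn1.
Qed.

Lemma claim_number_nat_infinite t w : (forall n, S n w <= t) ->
  claim_number_nat Z t w = 0%N.
Proof.
move=> St; rewrite /claim_number_nat.
suff -> : claim_number Z t w = +oo%E by rewrite /= truncn0.
apply: eq_infty => r; pose K := (Num.truncn r).+1.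
apply: (@le_trans _ _ (\sum_(1 <= n < K.+1) counted t n w)%E).
  rewrite (eq_bigr (fun=> 1%:E)); last by move=> n _; rewrite countedE St.
  by rewrite sumEFin sumr_const_nat subn1 lee_fin ltW// truncnS_gt.
by apply: nneseries_lim_ge => n _ _; exact: counted_ge0.
Qed.

Lemma renewal_index_exists t w n : 0 <= t -> t < S n w ->
  exists m, [/\ (m < n)%N, S m w <= t & t < S m.+1 w].
Proof.
move=> t0; elim: n => [|n IH]; first by rewrite big_ord0 ltNge t0.
move=> tn; have [nt|/IH[m [mn h1 h2]]] := leP (S n w) t; first by exists n.
by exists m; split => //; exact: ltnW.
Qed.

Lemma measurable_claim_number t : measurable_fun setT (claim_number Z t).
Proof.
have mc n : measurable_fun setT (counted t n).
  apply/measurable_EFinP; apply: measurable_indic.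
  by apply: measurable_set_le; exact: measurable_sum_RV.
have E w : claim_number Z t w =
    ((\sum_(0 <= n <oo) counted t n w) - counted t 0%N w)%E.
  rewrite (nneseries_split 0 1)//.
  by rewrite add0n big_nat1 [X in (X - _)%E]addeC addeK// countedE.
rewrite (funext E).
by apply: emeasurable_funB => //; apply: ge0_emeasurable_sum.
Qed.

Lemma measurable_claim_number_nat_le t n :
  measurable [set w | (claim_number_nat Z t w <= n)%N].
Proof.
have mg : measurable_fun setT (fun w => fine (claim_number Z t w)).
  by apply: measurableT_comp => //; exact: measurable_claim_number.
rewrite (_ : [set _ | _] = [set w | fine (claim_number Z t w) < n.+1%:R]).
  exact: measurable_set_lt.
by apply/seteqP; split => w /=; rewrite /claim_number_nat truncn_le_nat.
Qed.

Variable Y : nat -> {RV P >-> R}.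

Lemma measurable_net_loss_gt (q1 q2 c t x : R) :
  measurable [set w | x < proportional_net_loss Y Z q1 q2 c t w].
Proof.
rewrite (_ : [set _ | _] = \bigcup_n
  ([set w | (claim_number_nat Z t w <= n)%N] `&`
   ~` [set w | (claim_number_nat Z t w < n)%N] `&`
   [set w | x < q1 * (\sum_(i < n) Y i w) - q2 * c * S n w])).
  apply: bigcupT_measurable => n; apply: measurableI.
    apply: measurableI; first exact: measurable_claim_number_nat_le.
    apply: measurableC; case: n => [|n]; last exact: measurable_claim_number_nat_le.
    by rewrite (_ : [set _ | _] = set0)//; apply/seteqP; split.
  apply: measurable_set_gt; apply: measurable_funB.
    by apply: measurable_funM => //; exact: measurable_sum_RV.
  by apply: measurable_funM => //; exact: measurable_sum_RV.
apply/seteqP; split => w /=.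
  move=> h; exists (claim_number_nat Z t w) => //; split => //.
  by split => //=; rewrite ltnn.
move=> [n _ [[/= h1 /negP]]]; rewrite -leqNgt => h2.
have -> : n = claim_number_nat Z t w by apply/eqP; rewrite eqn_leq h1 h2.
by [].
Qed.

End claim_number_paths.

Section independence.
Context d (T : measurableType d) (R : realType) (P : probability T R).
Variables (X : nat -> {RV P >-> R}).

Let G : set (set T) := \bigcup_(i in [set: nat])
  preimage_set_system setT (X i : T -> R) measurable.

Let measurable_X i :
  measurable_fun (setT : set (g_sigma_algebraType G)) (X i : g_sigma_algebraType G -> R).
Proof.
move=> _ B mB; apply: sub_sigma_algebra; exists i => //.
by exists B.
Qed.

Lemma sigma_generated_sum_gt n u :
  sigma_generated (fun i => X i : T -> R) [set w | u < \sum_(i < n) X i w].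
Proof.
have : measurable ([set w | u < \sum_(i < n) X i w] : set (g_sigma_algebraType G)).
  by apply: measurable_set_gt; apply: measurable_sum => i; exact: measurable_X.
by [].
Qed.

Lemma sigma_generated_sum_le n u :
  sigma_generated (fun i => X i : T -> R) [set w | \sum_(i < n) X i w <= u].
Proof.
have : measurable ([set w | \sum_(i < n) X i w <= u] : set (g_sigma_algebraType G)).
  by apply: measurable_set_le; apply: measurable_sum => i; exact: measurable_X.
by [].
Qed.

Lemma sigma_generated_some_gt n u :
  sigma_generated (fun i => X i : T -> R)
    (\bigcup_(i in [set: 'I_n]) [set w | u < X i w]).
Proof.
have : measurable ((\bigcup_(i in [set: 'I_n]) [set w | u < X i w])
    : set (g_sigma_algebraType G)).
  apply: fin_bigcup_measurable; first exact: finite_finset.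
  by move=> i _; apply: measurable_set_gt; exact: measurable_X.
by [].
Qed.

End independence.

Lemma case1_setI d (T : measurableType d) (R : realType) (P : probability T R)
    (Y Z : nat -> {RV P >-> R}) (tau : {RV P >-> R}) (A B : set T) :
  case1 Y Z tau ->
  sigma_generated (fun i => Y i : T -> R) A ->
  sigma_generated (fun i => Z i : T -> R) B ->
  Pr P (A `&` B) = Pr P A * Pr P B.
Proof.
move=> [ind _] sA sB.
pose i0 : 'I_3 := ord0; pose i1 : 'I_3 := lift ord0 ord0.
have := ind [:: i0; i1] (fun i => if i == i0 then A else B) isT.
rewrite !big_cons big_nil eqxx mulr1 => <-; first congr (Pr P _).
  apply/seteqP; split => w /=.
    by move=> [Aw Bw] i; case: ifP.
  move=> h; split; first exact: (h i0 (mem_head _ _)).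
  by apply: (h i1); rewrite /= !inE eqxx orbT.
by move=> i; rewrite !inE => /orP[|] /eqP ->.
Qed.

(** * Comparison of the net loss with claim sums of fixed length *)

Section net_loss.
Context d (T : measurableType d) (R : realType) (P : probability T R).
Variables (Y Z : nat -> {RV P >-> R}) (G H : probability (measurableTypeR R) R).
Hypothesis Y_G : forall i, has_distribution (Y i) G.
Hypothesis G_ge0 : Pr G `[0, +oo[ = 1.
Hypothesis Z_H : forall i, has_distribution (Z i) H.
Hypothesis H_ge0 : Pr H `[0, +oo[ = 1.
Variables (q1 q2 c : R).
Hypothesis q1_gt0 : 0 < q1.
Let b := q2 * c.
Hypothesis b_ge0 : 0 <= b.

Local Notation S n w := (\sum_(i < n) Y i w).
Local Notation V n w := (\sum_(i < n) Z i w).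
Local Notation loss_gt x t := [set w | x < proportional_net_loss Y Z q1 q2 c t w].

Let N := some_negative Y `|` some_negative Z.

Let mN : measurable N.
Proof. by apply: measurableU; exact: measurable_some_negative. Qed.

Let N0 : Pr P N = 0.
Proof.
apply/eqP; rewrite eq_le Pr_ge0 andbT.
have := @Pr_leU _ _ _ P set0 N (some_negative Y) (some_negative Z) mN
  (measurable_some_negative Y) (measurable_some_negative Z) measurable0.
rewrite (Pr_some_negative Y_G G_ge0) (Pr_some_negative Z_H H_ge0) addr0.
by apply=> //; rewrite /Pr measure0.
Qed.

Let Y_ge0 w i : ~ N w -> 0 <= Y i w.
Proof. by move=> Nw; apply: not_some_negative => h; apply: Nw; left. Qed.

Let Z_ge0 w i : ~ N w -> 0 <= Z i w.
Proof. by move=> Nw; apply: not_some_negative => h; apply: Nw; right. Qed.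

Let sum_mono (X : nat -> R) m n : (forall i, 0 <= X i) -> (m <= n)%N ->
  \sum_(i < m) X i <= \sum_(i < n) X i.
Proof.
move=> X0 /subnK <-; elim: (n - m)%N => [|k IH]; first by rewrite add0n.
by rewrite addSn big_ord_recr/= (le_trans IH)// lerDl.
Qed.

Let mS n u : measurable [set w | u < S n w].
Proof. by apply: measurable_set_gt; exact: measurable_sum_RV. Qed.

Let mV n u : measurable [set w | V n w <= u].
Proof. by apply: measurable_set_le; exact: measurable_sum_RV. Qed.

Let mV' n u : measurable [set w | u < V n w].
Proof. by apply: measurable_set_gt; exact: measurable_sum_RV. Qed.

Let mZ n u : measurable (\bigcup_(i in [set: 'I_n]) [set w | u < Z i w]).
Proof.
apply: fin_bigcup_measurable; first exact: finite_finset.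
by move=> i _; apply: measurable_set_gt; exact: measurable_RV.
Qed.

(** If fewer than [n] claims occur before [t], the arrivals sum up to at least
    [t] minus one gap, and the claims to at most [S n]. Otherwise [n + m] claims occur,
    and the loss forces [S (n + m)] above [x / q1]. The last term accounts for
    all claim numbers from [n + K] on. *)
Lemma net_loss_upper (n K : nat) (e t x : R) : 0 <= t -> 0 <= x ->
  Pr P (loss_gt x t) <=
    Pr P [set w | q1^-1 * (x + b * (t - e * t)) < S n w] +
    Pr P ((\bigcup_(i in [set: 'I_n]) [set w | e * t < Z i w])
          `&` [set w | q1^-1 * x < S n w]) +
    \sum_(m < K) Pr P ([set w | V (n + m) w <= t]
          `&` [set w | q1^-1 * x < S (n + m) w]) +
    Pr P [set w | V (n + K) w <= t].
Proof.
move=> t0 x0.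
set A1 := [set w | q1^-1 * _ < _]; set A2 := _ `&` _.
pose A3 m := [set w | V (n + m) w <= t] `&` [set w | q1^-1 * x < S (n + m) w].
set A4 := [set w | V (n + K) w <= t].
have mA1 : measurable A1 by exact: mS.
have mA4 : measurable A4 by exact: mV.
have mA3 m : measurable (A3 m) by exact: measurableI.
have mA2 : measurable A2 by exact: measurableI.
have mA3U : measurable (\bigcup_(m in [set: 'I_K]) A3 m).
  by apply: fin_bigcup_measurable => //; exact: finite_finset.
have mL : measurable (loss_gt x t) by exact: measurable_net_loss_gt.
have H3 : Pr P (\bigcup_(m in [set: 'I_K]) A3 m) <= \sum_(m < K) Pr P (A3 m).
  by apply: (@Pr_le_sum _ _ _ _ _ N) => // w _ [i _ Ai]; exists i.
have H12 : Pr P (A1 `|` A2) <= Pr P A1 + Pr P A2.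
  by apply: (@Pr_leU _ _ _ _ N) => //; exact: measurableU.
have H34 : Pr P ((\bigcup_(m in [set: 'I_K]) A3 m) `|` A4) <=
    Pr P (\bigcup_(m in [set: 'I_K]) A3 m) + Pr P A4.
  by apply: (@Pr_leU _ _ _ _ N) => //; exact: measurableU.
have : Pr P (loss_gt x t) <= Pr P (A1 `|` A2) +
    Pr P ((\bigcup_(m in [set: 'I_K]) A3 m) `|` A4); last by rewrite -/A1; lra.
apply: (@Pr_leU _ _ _ _ N) => //; [exact: measurableU|exact: measurableU|].
move=> w Nw Lw.
have Z0 i := Z_ge0 i Nw; have Y0 i := Y_ge0 i Nw.
have [allV|] := pselect (forall k, V k w <= t).
  exfalso; move: Lw; rewrite /= /proportional_net_loss (claim_number_nat_infinite allV).
  by rewrite !big_ord0 !mulr0 subr0 ltNge x0.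
move=> /existsNP[k /negP]; rewrite -ltNge => /(renewal_index_exists t0)[m [_ Vm Vm1]].
move: Lw; rewrite /= /proportional_net_loss (claim_number_natE Z0 Vm Vm1) -/b => Lw.
have bV : 0 <= b * V m w by rewrite mulr_ge0// sumr_ge0.
have Sx : q1^-1 * x < S m w by rewrite ltr_pdivrMl//; lra.
have [mn|nm] := ltnP m n; last first.
  right; have [mK|Km] := ltnP m (n + K).
    have mnK : (m - n < K)%N by rewrite ltn_subLR.
    by left; exists (Ordinal mnK) => //; rewrite /A3/= subnKC.
  by right; rewrite /A4/= (le_trans _ Vm)//; exact: (sum_mono Z0).
left; have SS : S m w <= S n w by apply: (sum_mono Y0); exact: ltnW.
have [[i Zi]|nZ] := pselect (exists i : 'I_n, e * t < Z i w).
  by right; split; [exists i|rewrite /= (lt_le_trans Sx)].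
left; rewrite /A1/= ltr_pdivrMl//.
have Zm : Z m w <= e * t.
  rewrite leNgt; apply/negP => h; apply: nZ; exists (Ordinal mn); exact: h.
have Vlow : t - e * t <= V m w by move: Vm1; rewrite big_ord_recr/=; lra.
have := ler_wpM2l b_ge0 Vlow; have : q1 * S m w <= q1 * S n w by rewrite ler_pM2l.
by lra.
Qed.

(** When [V n <= t] at least [n] claims occur before [t], and the arrivals then
    sum up to at most [t]. The last term excludes infinitely many claims. *)
Lemma net_loss_lower (n K : nat) (t x : R) : 0 <= t ->
  Pr P [set w | q1^-1 * (x + b * t) < S n w] <=
    Pr P (loss_gt x t) +
    Pr P ([set w | t < V n w] `&` [set w | q1^-1 * x < S n w]) +
    Pr P [set w | V K w <= t].
Proof.
move=> t0; set A1 := [set w | q1^-1 * _ < _]; set A2 := _ `&` _.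
set A4 := [set w | V K w <= t].
have mA1 : measurable A1 by exact: mS.
have mA4 : measurable A4 by exact: mV.
have mA2 : measurable A2 by exact: measurableI.
have mL : measurable (loss_gt x t) by exact: measurable_net_loss_gt.
have H24 : Pr P (A2 `|` A4) <= Pr P A2 + Pr P A4.
  by apply: (@Pr_leU _ _ _ _ N) => //; exact: measurableU.
have : Pr P A1 <= Pr P (loss_gt x t) + Pr P (A2 `|` A4); last by lra.
apply: (@Pr_leU _ _ _ _ N) => //; first exact: measurableU.
move=> w Nw; rewrite /A1/= => Sw.
have Z0 i := Z_ge0 i Nw; have Y0 i := Y_ge0 i Nw.
have [Vn|Vn] := leP (V n w) t; last first.
  right; left; split=> //=; apply: le_lt_trans Sw.
  by rewrite ler_pM2l ?invr_gt0// lerDl mulr_ge0.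
have [VK|VK] := leP (V K w) t; first by right; right.
left; have [m [_ Vm Vm1]] := renewal_index_exists t0 VK.
rewrite /proportional_net_loss (claim_number_natE Z0 Vm Vm1) -/b.
have nm : (n <= m)%N.
  rewrite leqNgt; apply/negP => mn; move: Vm1; rewrite ltNge => /negP; apply.
  by apply: le_trans Vn; exact: (sum_mono Z0).
have SS : S n w <= S m w by exact: (sum_mono Y0).
rewrite ltr_pdivrMl// in Sw.
have := ler_wpM2l b_ge0 Vm; have : q1 * S n w <= q1 * S m w by rewrite ler_pM2l.
by lra.
Qed.

End net_loss.

(** * Uniform asymptotics of the net loss *)

Section uniform_asymptotics.
Context d (T : measurableType d) (R : realType) (P : probability T R).
Variables (Y Z : nat -> {RV P >-> R}) (G H : probability (measurableTypeR R) R).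
Variables (muG muH MG MH q1 q2 c : R).
Hypothesis Y_G : forall i, has_distribution (Y i) G.
Hypothesis G_ge0 : Pr G `[0, +oo[ = 1.
Hypothesis G_mean : mean G = muG%:E.
Hypothesis G_C : consistently_varying G.
Hypothesis Y_ENOD : ENOD Y MG.
Hypothesis Z_H : forall i, has_distribution (Z i) H.
Hypothesis H_ge0 : Pr H `[0, +oo[ = 1.
Hypothesis H_mean : mean H = muH%:E.
Hypothesis Z_ENOD : ENOD Z MH.
Hypothesis H_oG : littleo_pinfty (tail H) (tail G).
Hypothesis muG_gt0 : 0 < muG.
Hypothesis muH_gt0 : 0 < muH.
Hypothesis q1_gt0 : 0 < q1.
Let b := q2 * c.
Hypothesis b_ge0 : 0 <= b.
Hypothesis loading : q1 * muG < b * muH.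
Let nu := muH^-1.

Local Notation S n w := (\sum_(i < n) Y i w).
Local Notation V n w := (\sum_(i < n) Z i w).
Local Notation loss_gt x t := [set w | x < proportional_net_loss Y Z q1 q2 c t w].
Local Notation tG := (tail G).

Let MH0 : 0 < MH. Proof. exact: ENOD_coef_gt0 Z_ENOD. Qed.
Let nu0 : 0 < nu. Proof. by rewrite invr_gt0. Qed.

Let mS n u : measurable [set w | u < S n w].
Proof. by apply: measurable_set_gt; exact: measurable_sum_RV. Qed.

Let mV n u : measurable [set w | V n w <= u].
Proof. by apply: measurable_set_le; exact: measurable_sum_RV. Qed.

Let mV' n u : measurable [set w | u < V n w].
Proof. by apply: measurable_set_gt; exact: measurable_sum_RV. Qed.

Let mZ n u : measurable (\bigcup_(i in [set: 'I_n]) [set w | u < Z i w]).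
Proof.
apply: fin_bigcup_measurable; first exact: finite_finset.
by move=> i _; apply: measurable_set_gt; exact: measurable_RV.
Qed.

(** The estimates below assume, for each [x], either this independence or a
    bound [x <= Gamma * t]: the two halves of the theorem. *)
Definition independent_sequences : Prop := forall A B : set T,
  sigma_generated (fun i => Y i : T -> R) A ->
  sigma_generated (fun i => Z i : T -> R) B ->
  Pr P (A `&` B) = Pr P A * Pr P B.

Lemma many_arrivals e : 0 < e -> exists a : R, 0 < a /\ forall n t,
  (0 < n)%N -> t <= n%:R * (muH - e) ->
  Pr P [set w | V n w <= t] <= MH * expR (- (a * n%:R)).
Proof.
move=> e0; have [L [a [L0 [a0 lc]]]] := lower_chernoff Z_H H_ge0 H_mean Z_ENOD e0.
exists a; split=> // n t n0 tn; apply: le_trans (lc n n0).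
apply: (@Pr_le _ _ _ _ (some_negative Z)) => //.
- by apply: measurable_set_le; exact: measurable_sum_minRV.
- exact: measurable_some_negative.
- exact: Pr_some_negative.
move=> w _ /= Vt; apply: (@le_trans _ _ (V n w)); last by lra.
by apply: ler_sum => i _; rewrite ge_min lexx.
Qed.

(** For [x] of order [t] the bound on the probability of [B] alone suffices; for
    larger [x] independence supplies the factor [tG x], and [t * tG t] is
    bounded by the mean. *)
Lemma rare_event k gamma Gamma : 0 < k -> 0 < gamma ->
  exists C t0, 0 < C /\ 0 < t0 /\ forall e t x n (B : set T),
    0 <= e -> t0 <= t -> (0 < n)%N -> n%:R <= k * t -> gamma * t <= x ->
    measurable B -> Pr P B <= e * (t * tG t) ->
    x <= Gamma * t \/ Pr P (B `&` [set w | q1^-1 * x < S n w]) =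
      Pr P B * Pr P [set w | q1^-1 * x < S n w] ->
    Pr P (B `&` [set w | q1^-1 * x < S n w]) <= C * e * (t * tG x).
Proof.
move=> k0 g0.
pose Gam := Num.max Gamma 0 + 2 * q1 * k * muG + 1.
have mx0 : 0 <= Num.max Gamma 0 by rewrite le_max lexx orbT.
have mxG : Gamma <= Num.max Gamma 0 by rewrite le_max lexx.
have p0 : 0 < 2 * q1 * k * muG by rewrite !mulr_gt0.
have Gam0 : 0 < Gam by rewrite /Gam; lra.
have [C1 [C10 sc1]] := tail_scale G_C (divr_gt0 ltr01 Gam0).
pose r := (2 * q1)^-1.
have r0 : 0 < r by rewrite invr_gt0 mulr_gt0.
have [C2 [C20 sc2]] := tail_scale G_C r0.
have gg : 0 < r * Gam / k by rewrite !mulr_gt0// invr_gt0.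
have [x0 [x00 ld]] := large_deviation_le Y_G G_ge0 G_mean G_C Y_ENOD ltr01 gg.
pose C := C1 + muG * (2 * k * C2).
have C0 : 0 < C by rewrite addr_gt0// !mulr_gt0.
exists C, (x0 / (r * gamma)); split=> //; split; first by rewrite !divr_gt0// mulr_gt0.
move=> e t x n B e0 tt n0 nk gx mB PB indep.
have rg0 : 0 < r * gamma by rewrite mulr_gt0.
have t0 : 0 < t by apply: lt_le_trans tt; rewrite divr_gt0.
have xpos : 0 < x by apply: lt_le_trans gx; rewrite mulr_gt0.
have tGx : 0 < tG x by exact: tail_gt0.
have mSx := mS n (q1^-1 * x).
have [xG|Gx] := leP x (Gam * t).
  apply: (@le_trans _ _ (Pr P B)).
    apply: (@Pr_le _ _ _ _ set0) => //; first exact: measurableI.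
      by rewrite /Pr measure0.
    by move=> w _ [].
  apply: (le_trans PB).
  have : tG t <= C1 * tG x.
    apply: le_trans (sc1 x (ltW xpos)); apply: tail_nonincreasing.
    by rewrite mul1r ler_pdivrMl.
  move=> h; have : e * (t * tG t) <= e * (t * (C1 * tG x)).
    by rewrite ler_wpM2l// ler_pM2l.
  have : 0 <= e * (t * (muG * (2 * k * C2) * tG x)).
    by rewrite mulr_ge0// ltW// !mulr_gt0.
  by rewrite /C; lra.
have {}indep : Pr P (B `&` [set w | q1^-1 * x < S n w]) =
      Pr P B * Pr P [set w | q1^-1 * x < S n w].
  case: indep => // xG; exfalso; move: Gx; rewrite ltNge => /negP; apply.
  apply: (le_trans xG); rewrite ler_pM2r//.
  by rewrite /Gam; lra.
rewrite indep.
have big : Pr P [set w | q1^-1 * x < S n w] <= 2 * k * C2 * (t * tG x).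
  apply: (@le_trans _ _ (Pr P [set w | n%:R * muG + r * x < S n w])).
    apply: (@Pr_le _ _ _ _ set0) => //; first by rewrite /Pr measure0.
    move=> w _ /=; apply: le_lt_trans.
    have : q1^-1 * x = 2 * (r * x) by rewrite /r; field; rewrite gt_eqF.
    move=> ->; suff : n%:R * muG <= r * x by lra.
    apply: (@le_trans _ _ (k * t * muG)); first by rewrite ler_pM2r.
    rewrite /r [leRHS]mulrC ler_pdivlMr ?mulr_gt0//.
    apply: le_trans (ltW Gx); rewrite /Gam.
    have : 0 <= (Num.max Gamma 0 + 1) * t by rewrite mulr_ge0 ?(ltW t0)//; lra.
    by lra.
  apply: (@le_trans _ _ ((1 + 1) * (n%:R * tG (r * x)))).
    apply: ld => //.
      move: tt; rewrite ler_pdivrMr// => h; apply: (le_trans h).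
      by rewrite mulrC -mulrA ler_pM2l.
    apply: (@le_trans _ _ (r * Gam / k * (k * t))).
      by rewrite ler_pM2l.
    rewrite (_ : r * Gam / k * (k * t) = r * (Gam * t)); last by field; rewrite gt_eqF.
    by rewrite ler_pM2l// ltW.
  have := sc2 x (ltW xpos) => h.
  have : n%:R * tG (r * x) <= k * t * (C2 * tG x).
    by apply: ler_pM => //; exact: tail_ge0.
  by lra.
have PB' : Pr P B <= e * muG.
  apply: (le_trans PB); rewrite ler_wpM2l//.
  exact: (mul_tail_le_mean G_ge0 G_mean).
apply: (@le_trans _ _ (e * muG * (2 * k * C2 * (t * tG x)))).
  by apply: ler_pM => //; exact: Pr_ge0.
have : 0 <= C1 * e * (t * tG x) by rewrite mulr_ge0// mulr_ge0// ltW// mulr_gt0.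
by rewrite /C; lra.
Qed.

Lemma geometric_sum_le (r : R) K : 0 <= r -> r < 1 ->
  \sum_(m < K) r ^+ m <= (1 - r)^-1.
Proof.
move=> r0 r1; have r1' : 0 < 1 - r by lra.
rewrite -[leRHS]mul1r ler_pdivlMr// mulrC.
rewrite -opprB mulNr -subrX1 opprB lerBlDr lerDl.
by rewrite exprn_ge0.
Qed.

(** The number of claims exceeds [n] with exponentially small probability,
    which beats the polynomial growth of the crude bound on [S]. *)
Lemma late_claims e : 0 < e -> independent_sequences ->
  exists Q, 0 < Q /\ forall t x n K, 0 < x -> (0 < n)%N ->
    t <= n%:R * (muH - e) -> 0 <= muH - e ->
    \sum_(m < K) Pr P ([set w | V (n + m) w <= t]
          `&` [set w | q1^-1 * x < S (n + m) w]) <= Q * tG x.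
Proof.
move=> e0 indep; have [a [a0 arr]] := many_arrivals e0.
have [C [p [C1 pot]]] := potter G_C.
pose A := 1 + q1.
have A1 : 1 <= A by rewrite lerDl ltW.
have A0 : 0 < A by lra.
pose B := (2 * p.+2%:R) ^+ p.+1 / a ^+ p.+1 : R.
have B0 : 0 < B by rewrite divr_gt0 ?exprn_gt0 ?mulr_gt0.
pose r := expR (- (a / 2)).
have r0 : 0 < r by exact: expR_gt0.
have r1 : r < 1 by rewrite /r -[ltRHS]expR0 ltr_expR oppr_lt0 divr_gt0.
pose W := MH * (C * A ^+ p) * B.
have C0 : 0 < C by lra.
have W0 : 0 < W.
  by apply: mulr_gt0 => //; apply: mulr_gt0 => //; apply: mulr_gt0 => //; exact: exprn_gt0.
exists (W / (1 - r)); split; first by rewrite divr_gt0//; lra.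
move=> t x n K x0 n0 tn muHe.
apply: (@le_trans _ _ (\sum_(m < K) W * tG x * r ^+ m)); last first.
  rewrite -mulr_sumr (_ : W / (1 - r) * tG x = W * tG x * (1 - r)^-1); last by ring.
  apply: ler_wpM2l; first by apply: mulr_ge0; [exact: ltW|exact: tail_ge0].
  by apply: geometric_sum_le => //; exact: ltW.
apply: ler_sum => m _; set k := (n + m)%N.
have k0 : (0 < k)%N by rewrite /k addn_gt0 n0.
have kr0 : 0 < k%:R :> R by rewrite ltr0n.
have k1 : 1 <= k%:R :> R by rewrite ler1n.
rewrite setIC indep; [|exact: sigma_generated_sum_gt|exact: sigma_generated_sum_le].
have h1 : Pr P [set w | V k w <= t] <= MH * expR (- (a * k%:R)).
  apply: arr => //; apply: (le_trans tn); rewrite ler_wpM2r// ler_nat.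
  exact: leq_addr.
have h2 : Pr P [set w | q1^-1 * x < S k w] <= k%:R * (C * (A * k%:R) ^+ p * tG x).
  apply: (le_trans (Pr_sum_gt_crude Y_G G_ge0 _ k0)).
  rewrite ler_pM2l//.
  have l1 : 1 <= A * k%:R by nra.
  have := pot (q1^-1 * x / k%:R) _ l1 => h; apply: (le_trans h).
  rewrite ler_wpM2l//.
    by rewrite mulr_ge0 ?exprn_ge0//; lra.
  apply: tail_nonincreasing.
  rewrite (_ : A * _ * _ = A / q1 * x); last by field; rewrite !gt_eqF.
  by rewrite ler_peMl ?(ltW x0)// ler_pdivlMr// mul1r lerDr.
apply: (@le_trans _ _ ((k%:R * (C * (A * k%:R) ^+ p * tG x)) *
   (MH * expR (- (a * k%:R))))).
  by apply: ler_pM => //; exact: Pr_ge0.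
have h3 : k%:R ^+ p.+1 * expR (- (a * k%:R)) <= B * r ^+ m.
  have ak0 : 0 <= a * k%:R by rewrite mulr_ge0// ltW.
  have := pow_le_expR p.+1 ak0; rewrite exprMn => h.
  have : r ^+ k <= r ^+ m.
    by rewrite ler_wiXn2l// ?(ltW r0) ?(ltW r1)// leq_addl.
  have rk : r ^+ k = expR (- (a * k%:R / 2)).
    by rewrite /r -expRM_natr; congr expR; ring.
  rewrite rk => h'.
  apply: (@le_trans _ _ (B * expR (- (a * k%:R / 2)))); last by rewrite ler_pM2l.
  rewrite /B mulrAC ler_pdivlMr ?exprn_gt0//.
  have -> : expR (- (a * k%:R)) = expR (- (a * k%:R / 2)) * expR (- (a * k%:R / 2)).
    by rewrite -expRD; congr expR; field.
  rewrite (_ : k%:R ^+ p.+1 * _ * _ = (a ^+ p.+1 * k%:R ^+ p.+1 *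
    expR (- (a * k%:R / 2))) * expR (- (a * k%:R / 2))); last by ring.
  rewrite ler_wpM2r ?expR_ge0// expRN ler_pdivrMr ?expR_gt0//.
rewrite exprMn.
rewrite [leLHS](_ : _ = MH * (C * A ^+ p) * tG x *
   (k%:R ^+ p.+1 * expR (- (a * k%:R)))); last by rewrite exprS; ring.
rewrite (_ : W * tG x * r ^+ m = MH * (C * A ^+ p) * tG x * (B * r ^+ m)); last by rewrite /W; ring.
apply: ler_wpM2l => //; apply: mulr_ge0; last exact: tail_ge0.
apply: mulr_ge0; first exact: ltW.
by apply: mulr_ge0; [exact: ltW|apply: exprn_ge0; exact: ltW].
Qed.

Lemma finite_arrivals t del : 0 < del -> exists K0, forall K, (K0 <= K)%N ->
  Pr P [set w | V K w <= t] <= del.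
Proof.
move=> d0; have [a [a0 arr]] := many_arrivals (divr_gt0 muH_gt0 (ltr0n R 2)).
have h0 : 0 < muH / 2 by rewrite divr_gt0.
exists (Num.truncn (Num.max (t / (muH / 2)) (MH / del / a))).+1 => K KK.
have : Num.max (t / (muH / 2)) (MH / del / a) <= K%:R.
  by apply/ltW/(lt_le_trans (truncnS_gt _)); rewrite ler_nat.
rewrite ge_max => /andP[K1 K2].
have K0 : (0 < K)%N by exact: leq_trans KK.
have tK : t <= K%:R * (muH - muH / 2).
  rewrite (_ : muH - muH / 2 = muH / 2); last by field.
  by rewrite -ler_pdivrMr.
apply: (le_trans (arr K t K0 tK)).
rewrite expRN ler_pdivrMr ?expR_gt0//.
have : MH <= del * (a * K%:R).
  move: K2; rewrite ler_pdivrMr// ler_pdivrMr// => h; apply: (le_trans h).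
  by apply: eq_ler; ring.
move=> /le_trans; apply; rewrite ler_pM2l//.
by apply: le_trans (expR_ge1Dx _); rewrite lerDr.
Qed.

(** With independence [K] grows until the remainder is negligible; without it
    [K = 0] does, since [x] is then of order [n]. *)
Lemma overflow_negligible dlt e gamma Gamma : 0 < dlt -> 0 < e -> 0 < gamma ->
  exists t0, 0 < t0 /\ forall t x n, t0 <= t -> (0 < n)%N ->
    (1 + dlt) * nu * t <= n%:R -> n%:R <= 2 * nu * t -> gamma * t <= x ->
    x <= Gamma * t \/ independent_sequences ->
    exists K,
      \sum_(m < K) Pr P ([set w | V (n + m) w <= t]
          `&` [set w | q1^-1 * x < S (n + m) w]) +
      Pr P [set w | V (n + K) w <= t] <= e * (t * tG x).
Proof.
move=> d0 e0 g0; pose eH := muH * dlt / (1 + dlt).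
have d1 : 0 < 1 + dlt by lra.
have eH0 : 0 < eH by rewrite divr_gt0// mulr_gt0.
have eHE : muH - eH = muH / (1 + dlt) by rewrite /eH; field; rewrite gt_eqF.
have eH1 : 0 <= muH - eH by rewrite eHE divr_ge0// ltW.
have tn n t : (1 + dlt) * nu * t <= n%:R -> t <= n%:R * (muH - eH).
  rewrite eHE mulrA ler_pdivlMr// => h.
  have := ler_wpM2r (ltW muH_gt0) h; apply: le_trans.
  by apply: eq_ler; rewrite /nu; field; rewrite gt_eqF.
have [a [a0 arr]] := many_arrivals eH0.
pose A := Num.max Gamma 0 / nu + 1.
have mx0 : 0 <= Num.max Gamma 0 by rewrite le_max lexx orbT.
have A0 : 0 < A.
  by have : 0 <= Num.max Gamma 0 / nu; [rewrite divr_ge0// ltW|rewrite /A; lra].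
have f0 : 0 < e / (MH * (2 * nu)) by rewrite divr_gt0// mulr_gt0// mulr_gt0.
have [n0 [n00 ex]] := expR_le_tail G_C a0 A0 f0.
have [Q [Q0 late]] : exists Q, 0 < Q /\ (independent_sequences ->
   forall t x n K, 0 < x -> (0 < n)%N -> t <= n%:R * (muH - eH) ->
    \sum_(m < K) Pr P ([set w | V (n + m) w <= t]
          `&` [set w | q1^-1 * x < S (n + m) w]) <= Q * tG x).
  have [ind|nind] := pselect independent_sequences; last by exists 1.
  have [Q [Q0 H0]] := late_claims eH0 ind; exists Q; split=> // _ t x n K x0 n1 tnn.
  exact: H0.
exists (n0%:R / nu + 2 * Q / e).
have q0 : 0 < n0%:R / nu by rewrite divr_gt0// ltr0n.
have q1' : 0 < 2 * Q / e by rewrite divr_gt0// mulr_gt0.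
split; first by lra.
move=> t x n tt n1 nlow nup gx cases.
have t0 : 0 < t by lra.
have x0 : 0 < x by apply: lt_le_trans gx; rewrite mulr_gt0.
have tG0 : 0 < tG x by exact: tail_gt0.
have [xG|ind] := cases.
  exists 0%N; rewrite big_ord0 add0r addn0.
  apply: (le_trans (arr n t n1 (tn _ _ nlow))).
  have nn : nu * t <= n%:R.
    by apply: le_trans nlow; rewrite ler_pM2r// ler_peMl ?(ltW nu0)//; lra.
  have n0n : (n0 <= n)%N.
    rewrite -(ler_nat R); apply: le_trans nn.
    by rewrite mulrC -ler_pdivrMr//; lra.
  have xA : x <= A * n%:R.
    apply: (le_trans xG); apply: (@le_trans _ _ (Num.max Gamma 0 * t)).
      by rewrite ler_pM2r// le_max lexx.
    apply: (@le_trans _ _ (Num.max Gamma 0 / nu * n%:R)); last first.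
      by rewrite ler_wpM2r// /A; lra.
    rewrite -mulrA ler_wpM2l//.
    by rewrite mulrC ler_pdivlMr// mulrC.
  have := ex n x n0n xA; rewrite -(ler_pM2l MH0) => /le_trans; apply.
  rewrite [leLHS](_ : _ = e / (2 * nu) * (n%:R * tG x)); last by field; rewrite !gt_eqF.
  have : n%:R * tG x <= 2 * nu * t * tG x by rewrite ler_pM2r.
  have h : 0 < e / (2 * nu) by rewrite divr_gt0// mulr_gt0.
  move=> /(ler_wpM2l (ltW h)) /le_trans; apply.
  by apply: eq_ler; field; rewrite !gt_eqF.
have d2 : 0 < e / 2 * (t * tG x) by rewrite mulr_gt0 ?divr_gt0// mulr_gt0.
have [K0 HK] := finite_arrivals t d2.
exists K0; have h1 := late ind t x n K0 x0 n1 (tn _ _ nlow).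
have h2 := HK (n + K0)%N (leq_addl _ _).
have : Q * tG x <= e / 2 * (t * tG x).
  rewrite mulrA ler_pM2r//; have : 2 * Q / e <= t by lra.
  by rewrite ler_pdivrMr//; lra.
by lra.
Qed.

Lemma long_gap_negligible f e : 0 < f -> 0 < e ->
  exists t0, 0 < t0 /\ forall t n, t0 <= t -> n%:R <= 2 * nu * t ->
    Pr P (\bigcup_(i in [set: 'I_n]) [set w | f * t < Z i w]) <= e * (t * tG t).
Proof.
move=> f0 e0; have n20 : 0 < 2 * nu by rewrite mulr_gt0.
have [t0 [t00 Ht]] := littleo_tail_scale G_C H_oG f0 (divr_gt0 e0 n20).
exists t0; split=> // t n tt nn; have tpos : 0 < t by lra.
apply: (le_trans (Pr_some_gt Z_H H_ge0 n (f * t))).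
apply: (@le_trans _ _ (2 * nu * t * (e / (2 * nu) * tG t))).
  by apply: ler_pM => //; [exact: tail_ge0|exact: Ht].
by apply: eq_ler; field; rewrite gt_eqF.
Qed.

Lemma few_arrivals_negligible dlt e : 0 < dlt -> dlt <= 1 / 4 -> 0 < e ->
  exists t0, 0 < t0 /\ forall t n, t0 <= t ->
    (1 - 2 * dlt) * nu * t <= n%:R -> n%:R <= (1 - dlt) * nu * t ->
    Pr P [set w | t < V n w] <= e * (t * tG t).
Proof.
move=> d0 d1 e0; have th0 : 0 < dlt * muH by rewrite mulr_gt0.
have n20 : 0 < nu / 2 by rewrite divr_gt0.
have [C [C0 sc]] := tail_scale G_C n20.
have f0 : 0 < e / (nu * C) by rewrite divr_gt0// mulr_gt0.
have [n0 [n00 Hn]] := sum_exceed_mean Z_H H_ge0 H_mean Z_ENOD G_ge0 G_mean G_C H_oG th0 f0.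
exists (n0%:R / (nu / 2)); split; first by rewrite divr_gt0// ltr0n.
move=> t n; rewrite ler_pdivrMr// => tt nlow nup.
have t0 : 0 < t by rewrite -(pmulr_lgt0 _ n20) (lt_le_trans _ tt)// ltr0n.
have nut0 : 0 < nu * t by rewrite mulr_gt0.
have nh : nu / 2 * t <= n%:R.
  apply: le_trans nlow; have : 0 <= (1 / 2 - 2 * dlt) * (nu * t).
    by rewrite mulr_ge0 ?(ltW nut0)//; lra.
  by lra.
have n0n : (n0 <= n)%N by rewrite -(ler_nat R); apply: le_trans nh; rewrite mulrC.
apply: (@le_trans _ _ (Pr P [set w | n%:R * (muH + dlt * muH) < V n w])).
  apply: (@Pr_le _ _ _ _ set0) => //; first by rewrite /Pr measure0.
  move=> w _ /=; apply: le_lt_trans.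
  have m0 : 0 <= muH + dlt * muH by rewrite addr_ge0// ltW.
  apply: (le_trans (ler_wpM2r m0 nup)).
  rewrite (_ : _ * _ = (1 - dlt ^+ 2) * t); last by rewrite /nu; field; rewrite gt_eqF.
  by rewrite ler_piMl ?(ltW t0)// gerBl exprn_ge0// ltW.
apply: (le_trans (Hn n n0n)).
have nle : n%:R <= nu * t.
  apply: (le_trans nup); rewrite -mulrA ler_piMl ?(ltW nut0)//.
  by rewrite gerBl ltW.
have tt' : tG n%:R <= C * tG t.
  by apply: le_trans (sc t (ltW t0)); exact: tail_nonincreasing.
apply: (@le_trans _ _ (e / (nu * C) * (nu * t * (C * tG t)))).
  by rewrite ler_pM2l//; apply: ler_pM => //; exact: tail_ge0.
by apply: eq_ler; field; rewrite !gt_eqF.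
Qed.

Lemma rare_with_independence (B : set T) (t x Gamma : R) n :
  x <= Gamma * t \/ independent_sequences ->
  (independent_sequences -> sigma_generated (fun i => Z i : T -> R) B) ->
  x <= Gamma * t \/ Pr P (B `&` [set w | q1^-1 * x < S n w]) =
    Pr P B * Pr P [set w | q1^-1 * x < S n w].
Proof.
case=> [xG|ind] sB; [by left|right].
have {}sB := sB ind; rewrite setIC [RHS]mulrC.
by apply: ind => //; exact: sigma_generated_sum_gt.
Qed.

Lemma upper_errors dlt f e gamma Gamma : 0 < dlt -> dlt <= 1 / 2 -> 0 < f ->
  0 < e -> 0 < gamma -> exists t0, 0 < t0 /\ forall t x, t0 <= t ->
    gamma * t <= x -> x <= Gamma * t \/ independent_sequences ->
    exists n K : nat, (0 < n)%N /\ n%:R <= (1 + 2 * dlt) * (nu * t) /\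
      Pr P ((\bigcup_(i in [set: 'I_n]) [set w | f * t < Z i w])
          `&` [set w | q1^-1 * x < S n w]) <= e * (t * tG x) /\
      \sum_(m < K) Pr P ([set w | V (n + m) w <= t]
          `&` [set w | q1^-1 * x < S (n + m) w]) +
      Pr P [set w | V (n + K) w <= t] <= e * (t * tG x).
Proof.
move=> d0 d1 f0 e0 g0; have n20 : 0 < 2 * nu by rewrite mulr_gt0.
have [C [t1 [C0 [t10 rare]]]] := rare_event Gamma n20 g0.
have [t2 [t20 gap]] := long_gap_negligible f0 (divr_gt0 e0 C0).
have [t3 [t30 over]] := overflow_negligible Gamma d0 e0 g0.
have dn0 : 0 < (dlt * nu)^-1 by rewrite invr_gt0 mulr_gt0.
exists (t1 + t2 + t3 + (dlt * nu)^-1); split; first by rewrite !addr_gt0.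
move=> t x tt gx cases.
have [tt1 tt2 tt3 tt4] : [/\ t1 <= t, t2 <= t, t3 <= t & (dlt * nu)^-1 <= t].
  by split; lra.
have t0 : 0 < t by exact: lt_le_trans tt1.
have nt0 : 0 < nu * t by rewrite mulr_gt0.
have dnt : 1 <= dlt * (nu * t) by rewrite mulrA -ler_pdivrMl ?mulr_gt0// mulr1.
pose n := (Num.truncn ((1 + dlt) * (nu * t))).+1.
have nlow : (1 + dlt) * (nu * t) <= n%:R by rewrite ltW// truncnS_gt.
have nup : n%:R <= (1 + 2 * dlt) * (nu * t).
  have : (Num.truncn ((1 + dlt) * (nu * t)))%:R <= (1 + dlt) * (nu * t).
    by rewrite truncn_le mulr_ge0// ?(ltW nt0)// addr_ge0// ltW.
  rewrite /n -[_.+1]addn1 natrD; lra.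
have n1 : (0 < n)%N by [].
clearbody n.
have nup2 : n%:R <= 2 * nu * t.
  by apply: (le_trans nup); rewrite -mulrA ler_pM2r//; lra.
have nlow' : (1 + dlt) * nu * t <= n%:R by rewrite -mulrA.
have [K HK] := over t x n tt3 n1 nlow' nup2 gx cases.
exists n, K; do 3!split => //.
have := rare (e / C) t x n _ (ltW (divr_gt0 e0 C0)) tt1 n1 nup2 gx (mZ n (f * t))
  (gap t n tt2 nup2).
rewrite (_ : C * (e / C) = e); last by rewrite mulrC divfK// gt_eqF.
apply; apply: rare_with_independence cases _ => _.
exact: sigma_generated_some_gt.
Qed.

Lemma lower_errors dlt e gamma Gamma (n0 : nat) : 0 < dlt -> dlt <= 1 / 4 -> 0 < e ->
  0 < gamma -> exists t0, 0 < t0 /\ forall t x, t0 <= t ->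
    gamma * t <= x -> x <= Gamma * t \/ independent_sequences ->
    exists n : nat, (n0 <= n)%N /\ (1 - 2 * dlt) * (nu * t) <= n%:R /\
      n%:R <= nu * t /\
      Pr P ([set w | t < V n w] `&` [set w | q1^-1 * x < S n w])
        <= e * (t * tG x).
Proof.
move=> d0 d1 e0 g0; have n20 : 0 < 2 * nu by rewrite mulr_gt0.
have [C [t1 [C0 [t10 rare]]]] := rare_event Gamma n20 g0.
have [t2 [t20 few]] := few_arrivals_negligible d0 d1 (divr_gt0 e0 C0).
have dn0 : 0 < (dlt * nu)^-1 by rewrite invr_gt0 mulr_gt0.
have nn0 : 0 < n0.+1%:R / (nu / 2) by rewrite !divr_gt0.
exists (t1 + t2 + (dlt * nu)^-1 + n0.+1%:R / (nu / 2)).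
split; first by rewrite !addr_gt0.
move=> t x tt gx cases.
have [tt1 tt2 tt3 tt4] : [/\ t1 <= t, t2 <= t, (dlt * nu)^-1 <= t &
    n0.+1%:R / (nu / 2) <= t].
  by split; lra.
have t0 : 0 < t by exact: lt_le_trans tt1.
have nt0 : 0 < nu * t by rewrite mulr_gt0.
have dnt : 1 <= dlt * (nu * t) by rewrite mulrA -ler_pdivrMl ?mulr_gt0// mulr1.
pose n := Num.truncn ((1 - dlt) * (nu * t)).
have nup : n%:R <= (1 - dlt) * (nu * t).
  rewrite truncn_le mulr_ge0// ?(ltW nt0)//; lra.
have nlow : (1 - 2 * dlt) * (nu * t) <= n%:R.
  have := truncnS_gt ((1 - dlt) * (nu * t)).
  rewrite -/n -[_.+1]addn1 natrD; lra.
clearbody n.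
have nup1 : n%:R <= nu * t.
  by apply: (le_trans nup); rewrite ler_piMl ?(ltW nt0)// gerBl ltW.
have n0n : (n0 < n)%N.
  rewrite -(ltr_nat R); apply: lt_le_trans nlow.
  apply: (@lt_le_trans _ _ (n0.+1%:R)); first by rewrite ltr_nat.
  have nu20 : 0 < nu / 2 by rewrite divr_gt0.
  rewrite ler_pdivrMr// in tt4; apply: (le_trans tt4).
  rewrite (_ : t * (nu / 2) = 1 / 2 * (nu * t)); last by ring.
  by rewrite ler_pM2r//; lra.
have n1 : (0 < n)%N by exact: leq_ltn_trans n0n.
have nup2 : n%:R <= 2 * nu * t.
  apply: (le_trans nup1); rewrite -mulrA; lra.
exists n; split; first exact: ltnW.
do 2!split => //.
have nlow' : (1 - 2 * dlt) * nu * t <= n%:R by rewrite -mulrA.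
have nup' : n%:R <= (1 - dlt) * nu * t by rewrite -mulrA.
have := rare (e / C) t x n _ (ltW (divr_gt0 e0 C0)) tt1 n1 nup2 gx (mV' n t)
  (few t n tt2 nlow' nup').
rewrite (_ : C * (e / C) = e); last by rewrite mulrC divfK// gt_eqF.
apply; apply: rare_with_independence cases _ => _.
exact: sigma_generated_sum_gt.
Qed.

(** Replacing [n] by [nu * t], and one long gap by [f * t], shifts the level [y]
    by a small multiple of itself, as [y] is at least of order [t]; consistent
    variation absorbs the shift. *)
Lemma main_upper e kap : 0 < e -> e <= 1 / 20 -> 0 < kap ->
  exists dlt f t0, [/\ 0 < dlt, 0 < f & 0 < t0] /\
  forall t y (n : nat), t0 <= t -> kap * t <= y -> (0 < n)%N ->
    n%:R <= (1 + 2 * dlt) * (nu * t) ->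
    Pr P [set w | y + nu * t * muG - b / q1 * (f * t) < S n w] <=
      (1 + 6 * e) * (nu * t * tG y).
Proof.
move=> e0 e1 kap0.
have [eta [u0 [/andP[eta0 eta1] [u01 cv]]]] := consistent_variation G_C e0.
have bq0 : 0 <= b / q1 by rewrite divr_ge0// ltW.
have bq1 : 0 < 8 * (b / q1 + 1) by rewrite mulr_gt0// ltr_wpDl.
have ek0 : 0 < eta * kap by rewrite mulr_gt0.
pose f := eta * kap / (8 * (b / q1 + 1)).
have f0 : 0 < f by rewrite divr_gt0.
have bf : b / q1 * f <= eta * kap / 8.
  have : f * (8 * (b / q1 + 1)) = eta * kap by rewrite /f divfK// gt_eqF.
  by lra.
clearbody f; move: bq0 bf {bq1}; set bq := b / q1 => bq0 bf.
have nm0 : 0 < nu * muG by rewrite mulr_gt0.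
pose dlt := Num.min e (eta * kap / (8 * (nu * muG))).
have d0 : 0 < dlt by rewrite lt_min e0 divr_gt0// mulr_gt0.
have de : dlt <= e by rewrite ge_min lexx.
have dm : dlt * (nu * muG) <= eta * kap / 8.
  apply: (@le_trans _ _ (eta * kap / (8 * (nu * muG)) * (nu * muG))).
    by rewrite ler_pM2r// ge_min lexx orbT.
  by apply: eq_ler; field; rewrite !gt_eqF.
clearbody dlt.
have gn0 : 0 < kap / (4 * nu) by rewrite divr_gt0// mulr_gt0.
have [x1 [x10 ldu]] := large_deviation_le Y_G G_ge0 G_mean G_C Y_ENOD e0 gn0.
have w2 : 0 < 2 * x1 / kap by rewrite divr_gt0// mulr_gt0.
have u00 : 0 < u0 by exact: lt_le_trans u01.
have w3 : 0 < 2 * u0 / kap by rewrite divr_gt0// mulr_gt0.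
exists dlt, f, (2 * x1 / kap + 2 * u0 / kap).
split; first by split => //; rewrite addr_gt0.
move=> t y n tt ky n1 nup.
have tt1 : 2 * x1 / kap <= t by apply: le_trans tt; rewrite lerDl ltW.
have tt2 : 2 * u0 / kap <= t by apply: le_trans tt; rewrite lerDr ltW.
rewrite !ler_pdivrMr// in tt1 tt2.
have t0 : 0 < t by exact: lt_le_trans (addr_gt0 w2 w3) tt.
have nt0 : 0 < nu * t by rewrite mulr_gt0.
have kt0 : 0 < kap * t by rewrite mulr_gt0.
have y0 : 0 < y by exact: lt_le_trans ky.
have ey0 : 0 <= (1 - eta) * y by rewrite mulr_ge0 ?subr_ge0// ltW.
have hh : kap * t / 2 <= (1 - eta / 2) * y by lra.
have main : Pr P [set w | y + nu * t * muG - bq * (f * t) < S n w] <=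
    (1 + e) * (n%:R * tG ((1 - eta / 2) * y)).
  apply: (@le_trans _ _ (Pr P [set w | n%:R * muG + (1 - eta / 2) * y < S n w])).
    apply: (@Pr_le _ _ _ _ set0) => //; first by rewrite /Pr measure0.
    move=> w _ /=; apply: le_lt_trans.
    have h1 := ler_wpM2r (ltW muG_gt0) nup.
    have h2 := ler_wpM2r (ltW t0) dm.
    have h3 := ler_wpM2r (ltW t0) bf.
    have h4 : 0 <= eta * (y - kap * t) by rewrite mulr_ge0 ?subr_ge0// ltW.
    have h5 : 0 <= eta * (kap * t) by rewrite mulr_ge0// ltW.
    by lra.
  apply: ldu => //.
    by apply: le_trans hh; lra.
  apply: le_trans hh.
  have nup2 : n%:R <= 2 * nu * t.
    apply: (le_trans nup); rewrite -mulrA ler_pM2r//; lra.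
  have := ler_wpM2l (ltW gn0) nup2; move=> /le_trans; apply.
  by apply: eq_ler; field; rewrite gt_eqF.
have cvY : (1 - e) * tG ((1 - eta / 2) * y) <= tG y.
  apply: cv; first by apply: le_trans hh; lra.
  have : 0 <= eta * ((1 - eta) * y) by rewrite mulr_ge0// ltW.
  by lra.
apply: (le_trans main).
have := tail_ge0 G ((1 - eta / 2) * y); move: (tG ((1 - eta / 2) * y)) cvY => g cvY g0.
have e10 : 0 <= 1 + e by rewrite addr_ge0// ltW.
have ng : n%:R * g <= (1 + 2 * e) * (nu * t) * g.
  rewrite ler_wpM2r//; apply: (le_trans nup).
  by rewrite ler_pM2r//; lra.
apply: (le_trans (ler_wpM2l e10 ng)).
have h3 : (1 + e) * (1 + 2 * e) <= (1 + 6 * e) * (1 - e).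
  have : 0 <= e * (2 - 8 * e) by rewrite mulr_ge0 ?(ltW e0)//; lra.
  by lra.
apply: (@le_trans _ _ ((1 + 6 * e) * (1 - e) * (nu * t * g))).
  rewrite (_ : (1 + e) * _ = (1 + e) * (1 + 2 * e) * (nu * t * g)); last by ring.
  by rewrite ler_wpM2r// mulr_ge0// ltW.
rewrite (_ : _ * (1 - e) * _ = (1 + 6 * e) * (nu * t) * ((1 - e) * g)); last by ring.
rewrite [leRHS]mulrA; apply: ler_wpM2l => //.
by rewrite mulr_ge0 ?(ltW nt0)//; lra.
Qed.

Lemma main_lower e kap : 0 < e -> e <= 1 / 20 -> 0 < kap ->
  exists dlt (n0 : nat) t0, [/\ 0 < dlt, (0 < n0)%N & 0 < t0] /\
  forall t y (n : nat), t0 <= t -> kap * t <= y -> (n0 <= n)%N ->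
    (1 - 2 * dlt) * (nu * t) <= n%:R -> n%:R <= nu * t ->
    (1 - 4 * e) * (nu * t * tG y) <= Pr P [set w | y + nu * t * muG < S n w].
Proof.
move=> e0 e1 kap0.
have [eta [u0 [/andP[eta0 eta1] [u01 cv]]]] := consistent_variation G_C e0.
have nm0 : 0 < nu * muG by rewrite mulr_gt0.
have ek0 : 0 < eta * kap by rewrite mulr_gt0.
pose dlt := Num.min e (eta * kap / (8 * (nu * muG))).
have d0 : 0 < dlt by rewrite lt_min e0 divr_gt0// mulr_gt0.
have de : dlt <= e by rewrite ge_min lexx.
have dm : dlt * (nu * muG) <= eta * kap / 8.
  apply: (@le_trans _ _ (eta * kap / (8 * (nu * muG)) * (nu * muG))).
    by rewrite ler_pM2r// ge_min lexx orbT.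
  by apply: eq_ler; field; rewrite !gt_eqF.
clearbody dlt.
have gn0 : 0 < kap / nu by rewrite divr_gt0.
have [n0 [n00 ldl]] := large_deviation_ge Y_G G_ge0 G_mean G_C Y_ENOD e0 gn0.
have u00 : 0 < u0 by exact: lt_le_trans u01.
have w3 : 0 < u0 / kap by rewrite divr_gt0.
exists dlt, n0, (u0 / kap); split=> // t y n tt ky n0n nlow nup.
have t0 : 0 < t by exact: lt_le_trans tt.
rewrite ler_pdivrMr// mulrC in tt.
have nt0 : 0 < nu * t by rewrite mulr_gt0.
have kt0 : 0 < kap * t by rewrite mulr_gt0.
have y0 : 0 < y by exact: lt_le_trans ky.
have tG0 := tail_gt0 G_C y.
have ey0 : 0 <= eta * y by rewrite mulr_ge0// ltW.
have main : (1 - e) * (n%:R * tG ((1 + eta) * y)) <=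
    Pr P [set w | y + nu * t * muG < S n w].
  apply: (@le_trans _ _ (Pr P [set w | n%:R * muG + (1 + eta) * y < S n w])).
    apply: ldl => //.
    have := ler_wpM2l (ltW gn0) nup; move=> /le_trans; apply.
    rewrite (_ : kap / nu * (nu * t) = kap * t); last by field; rewrite gt_eqF.
    by lra.
  apply: (@Pr_le _ _ _ _ set0) => //; first by rewrite /Pr measure0.
  move=> w _ /=; apply: le_lt_trans.
  have h1 := ler_wpM2r (ltW muG_gt0) nlow.
  have h2 := ler_wpM2r (ltW t0) dm.
  have h4 : 0 <= eta * (y - kap * t) by rewrite mulr_ge0 ?subr_ge0// ltW.
  have h5 : 0 <= eta * (kap * t) by rewrite mulr_ge0// ltW.
  by lra.
have cvY : (1 - e) * tG y <= tG ((1 + eta) * y).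
  by apply: cv => //; exact: le_trans ky.
apply: le_trans main.
have h1 : (1 - 2 * e) * (nu * t) <= n%:R.
  by apply: le_trans nlow; rewrite ler_pM2r//; lra.
have e1' : 0 <= 1 - e by lra.
have e2' : 0 <= 1 - 2 * e by lra.
have h2 : (1 - 2 * e) * (nu * t) * ((1 - e) * tG y) <= n%:R * tG ((1 + eta) * y).
  by apply: ler_pM => //; apply: mulr_ge0 => //; exact: ltW.
apply: le_trans (ler_wpM2l e1' h2).
rewrite [leRHS](_ : _ = (1 - 2 * e) * (1 - e) ^+ 2 * (nu * t * tG y)); last by ring.
rewrite ler_pM2r ?mulr_gt0//.
have : 0 <= e ^+ 2 * (5 - 2 * e).
  by rewrite mulr_ge0 ?exprn_ge0 ?(ltW e0)//; lra.
by lra.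
Qed.

Let y (t x : R) := q1^-1 * x - muG * nu * t + b * q1^-1 * t.

(** The shifted level grows linearly in [t], by the loading condition, and is
    at most proportional to [x]. *)
Lemma shifted_level gamma : 0 < gamma -> exists kap C, [/\ 0 < kap, 0 < C &
  forall t x, 0 < t -> gamma * t <= x ->
    kap * t <= y t x /\ tG x <= C * tG (y t x)].
Proof.
move=> g0; have qi0 : 0 < q1^-1 by rewrite invr_gt0.
have drift0 : 0 < b * q1^-1 - muG * nu.
  rewrite subr_gt0 ltr_pdivlMr// -(ltr_pM2r muH_gt0).
  by rewrite (_ : muG * nu * q1 * muH = q1 * muG)//; rewrite /nu; field; rewrite gt_eqF.
have bq0 : 0 <= b * q1^-1 by rewrite mulr_ge0// ltW.
have mn0 : 0 < muG * nu by rewrite mulr_gt0.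
pose lam := q1^-1 + b * q1^-1 / gamma.
have lam0 : 0 < lam by rewrite ltr_pwDl// divr_ge0// ltW.
have [C [C0 sc]] := tail_scale G_C (divr_gt0 ltr01 lam0).
exists (q1^-1 * gamma + (b * q1^-1 - muG * nu)), C; split=> //.
  by rewrite addr_gt0// mulr_gt0.
move=> t x t0 gx; have x0 : 0 < x by apply: lt_le_trans gx; rewrite mulr_gt0.
have h1 := ler_wpM2l (ltW qi0) gx.
split; first by rewrite /y; lra.
have h2 : b * q1^-1 * t <= b * q1^-1 / gamma * x.
  rewrite (_ : b * q1^-1 / gamma * x = b * q1^-1 * (x / gamma)); last by ring.
  by apply: ler_wpM2l => //; rewrite ler_pdivlMr// mulrC.
have h3 : 0 <= muG * nu * t by rewrite mulr_ge0// ltW.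
have yx : y t x <= lam * x by rewrite /y /lam mulrDl; lra.
have := sc (lam * x); rewrite mul1r mulKf ?gt_eqF// => h.
apply: (@le_trans _ _ (C * tG (lam * x))).
  by apply: h; rewrite mulr_ge0// ltW.
by rewrite ler_pM2l//; exact: tail_nonincreasing.
Qed.

Let rescale_error e C (t x : R) : 0 < C -> 0 < t -> 0 < e -> tG x <= C * tG (y t x) ->
  e * nu / C * (t * tG x) <= e * (nu * t * tG (y t x)).
Proof.
move=> C0 t0 e0 h; apply: (@le_trans _ _ (e * nu / C * (t * (C * tG (y t x))))).
  by rewrite ler_wpM2l ?ler_pM2l// divr_ge0// ?(ltW C0)// mulr_ge0// ltW.
by apply: eq_ler; field; rewrite gt_eqF.
Qed.

Lemma Pr_net_loss_le e gamma Gamma : 0 < e -> e <= 1 / 20 -> 0 < gamma ->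
  exists t0, 0 < t0 /\ forall t x, t0 <= t -> gamma * t <= x ->
    x <= Gamma * t \/ independent_sequences ->
    Pr P (loss_gt x t) <= (1 + 8 * e) * (nu * t * tG (y t x)).
Proof.
move=> e0 e1 g0; have [kap [C [kap0 C0 lev]]] := shifted_level g0.
have [dlt' [f [t1 [[d'0 f0 t10] main]]]] := main_upper e0 e1 kap0.
pose dlt := Num.min dlt' (1 / 2).
have d0 : 0 < dlt by rewrite lt_min d'0 divr_gt0.
have d1 : dlt <= 1 / 2 by rewrite ge_min lexx orbT.
have dd : dlt <= dlt' by rewrite ge_min lexx.
clearbody dlt.
have e'0 : 0 < e * nu / C by rewrite divr_gt0// mulr_gt0.
have [t2 [t20 err]] := upper_errors Gamma d0 d1 f0 e'0 g0.
exists (t1 + t2); split; first by rewrite addr_gt0.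
move=> t x tt gx cases.
have tt1 : t1 <= t by apply: le_trans tt; rewrite lerDl ltW.
have tt2 : t2 <= t by apply: le_trans tt; rewrite lerDr ltW.
have t0 : 0 < t by exact: lt_le_trans tt1.
have x0 : 0 < x by apply: lt_le_trans gx; rewrite mulr_gt0.
have [ky tGx] := lev t x t0 gx.
have [n [K [n1 [nup [E1 E2]]]]] := err t x tt2 gx cases.
have res := rescale_error C0 t0 e0 tGx.
have up := net_loss_upper Y_G G_ge0 Z_H H_ge0 q1_gt0 b_ge0 n K f (ltW t0) (ltW x0).
have nup' : n%:R <= (1 + 2 * dlt') * (nu * t).
  apply: (le_trans nup); rewrite ler_pM2r ?mulr_gt0//; lra.
have := main t (y t x) n tt1 ky n1 nup'.
have -> : y t x + nu * t * muG - b / q1 * (f * t) =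
    q1^-1 * (x + b * (t - f * t)) by rewrite /y; ring.
move=> m; apply: (le_trans up).
move: m (le_trans E1 res) (le_trans E2 res); lra.
Qed.

Lemma Pr_net_loss_ge e gamma Gamma : 0 < e -> e <= 1 / 20 -> 0 < gamma ->
  exists t0, 0 < t0 /\ forall t x, t0 <= t -> gamma * t <= x ->
    x <= Gamma * t \/ independent_sequences ->
    (1 - 6 * e) * (nu * t * tG (y t x)) <= Pr P (loss_gt x t).
Proof.
move=> e0 e1 g0; have [kap [C [kap0 C0 lev]]] := shifted_level g0.
have [dlt' [n0 [t1 [[d'0 n00 t10] main]]]] := main_lower e0 e1 kap0.
pose dlt := Num.min dlt' (1 / 4).
have d0 : 0 < dlt by rewrite lt_min d'0 divr_gt0.
have d1 : dlt <= 1 / 4 by rewrite ge_min lexx orbT.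
have dd : dlt <= dlt' by rewrite ge_min lexx.
clearbody dlt.
have e'0 : 0 < e * nu / C by rewrite divr_gt0// mulr_gt0.
have [t2 [t20 err]] := lower_errors Gamma n0 d0 d1 e'0 g0.
exists (t1 + t2); split; first by rewrite addr_gt0.
move=> t x tt gx cases.
have tt1 : t1 <= t by apply: le_trans tt; rewrite lerDl ltW.
have tt2 : t2 <= t by apply: le_trans tt; rewrite lerDr ltW.
have t0 : 0 < t by exact: lt_le_trans tt1.
have [ky tGx] := lev t x t0 gx.
have [n [n0n [nlow [nup E1]]]] := err t x tt2 gx cases.
have res := rescale_error C0 t0 e0 tGx.
have tG0 := tail_gt0 G_C (y t x).
have eD0 : 0 < e * (nu * t * tG (y t x)) by rewrite mulr_gt0// mulr_gt0// mulr_gt0.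
have [K HK] := finite_arrivals t eD0.
have {}HK := HK K (leqnn K).
have low := net_loss_lower Y_G G_ge0 Z_H H_ge0 q1_gt0 b_ge0 n K x (ltW t0).
have nlow' : (1 - 2 * dlt') * (nu * t) <= n%:R.
  by apply: le_trans nlow; rewrite ler_pM2r ?mulr_gt0//; lra.
have := main t (y t x) n tt1 ky n0n nlow' nup.
have -> : y t x + nu * t * muG = q1^-1 * (x + b * t) by rewrite /y; ring.
move=> m; have {}low := le_trans m low.
move: low (le_trans E1 res) HK; lra.
Qed.

Lemma relative_error_le eps gamma Gamma : 0 < eps -> 0 < gamma ->
  exists t0, 0 < t0 /\ forall t x, t0 <= t -> gamma * t <= x ->
    x <= Gamma * t \/ independent_sequences ->
    relative_error Y Z G muG muH q1 q2 c t x <= eps.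
Proof.
move=> eps0 g0.
pose e := Num.min eps 1 / 20.
have e0 : 0 < e by rewrite divr_gt0// lt_min eps0 ltr01.
have e1 : e <= 1 / 20 by rewrite ler_pM2r ?invr_gt0// ge_min lexx orbT.
have eeps : 20 * e <= eps by rewrite /e mulrC divfK// ge_min lexx.
clearbody e.
have [t1 [t10 up]] := Pr_net_loss_le Gamma e0 e1 g0.
have [t2 [t20 low]] := Pr_net_loss_ge Gamma e0 e1 g0.
exists (t1 + t2); split; first by rewrite addr_gt0.
move=> t x tt gx cases.
have tt1 : t1 <= t by apply: le_trans tt; rewrite lerDl ltW.
have tt2 : t2 <= t by apply: le_trans tt; rewrite lerDr ltW.
have t0 : 0 < t by exact: lt_le_trans tt1.
have {}up := up t x tt1 gx cases; have {}low := low t x tt2 gx cases.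
have D0 : 0 < nu * t * tG (y t x).
  by rewrite mulr_gt0 ?mulr_gt0//; exact: tail_gt0.
rewrite /relative_error -/b -/nu -/(y t x).
move: up low D0; set D := nu * t * _ => up low D0.
have h1 := ler_wpM2r (ltW D0) eeps.
have h2 : 0 <= e * D by rewrite mulr_ge0// ltW.
rewrite ler_norml lerBrDr lerBlDr ler_pdivlMr// ler_pdivrMr//.
by apply/andP; split; lra.
Qed.

End uniform_asymptotics.

Lemma ereal_sup_cvg0 (R : realType) (A : R -> set R) (f : R -> R -> R) :
  (forall t x, 0 <= f t x) ->
  (forall t, 0 < t -> A t !=set0) ->
  (forall eps, 0 < eps -> exists t0, 0 < t0 /\
     forall t x, t0 <= t -> A t x -> f t x <= eps) ->
  ereal_sup [set (f t x)%:E | x in A t] @[t --> +oo] --> 0%E.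
Proof.
move=> f0 A0 fe; set g := fun t => ereal_sup _.
have near_g eps : 0 < eps -> \forall t \near +oo, (0 <= g t <= eps%:E)%E.
  move=> /fe[t0 [t00 H]]; exists t0; split; first exact: num_real.
  move=> t /ltW tt; apply/andP; split.
    have [x Ax] := A0 t (lt_le_trans t00 tt).
    apply: (@le_trans _ _ (f t x)%:E); first by rewrite lee_fin.
    by apply: ereal_sup_ubound; exists x.
  by apply: ge_ereal_sup => _ [x Ax <-]; rewrite lee_fin; exact: H.
have fin_g t eps : (0 <= g t <= eps%:E)%E -> g t \is a fin_num.
  move=> /andP[g0 ge]; rewrite ge0_fin_numE//.
  by apply: le_lt_trans ge _; rewrite ltry.
apply/fine_cvgP; split.
  by apply: filterS (near_g 1 ltr01) => t; exact: fin_g.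
apply/cvgrPdist_le => eps e0; apply: filterS (near_g eps e0) => t gt /=.
rewrite sub0r normrN; have gf := fin_g _ _ gt; move: gt => /andP[g0 ge].
by rewrite ger0_norm ?fine_ge0// -lee_fin fineK.
Qed.

Theorem theorem4p1 (d : measure_display) (T : measurableType d) (R : realType)
    (P : probability T R) (Y Z : nat -> {RV P >-> R}) (tau : {RV P >-> R})
    (G H : probability (measurableTypeR R) R)
    (muG muH c q1 q2 MG MH : R)
    (model : renewal_risk_model Y Z tau G H muG muH c)
    (q1_gt0 : 0 < q1) (q1_le1 : q1 <= 1) (q2_ge0 : 0 <= q2) (q2_le1 : q2 <= 1)
    (loading : q1 * muG < q2 * c * muH)
    (Y_ENOD : ENOD Y MG) (G_C : consistently_varying G) (Z_ENOD : ENOD Z MH)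
    (H_oG : littleo_pinfty (tail H) (tail G)) :
  (case1 Y Z tau ->
    forall gamma : R, q1 * muG < gamma ->
      ereal_sup [set (relative_error Y Z G muG muH q1 q2 c t x)%:E
                | x in [set x : R | gamma * t <= x]] @[t --> +oo] --> 0%E) /\
  (case2 Y Z tau ->
    forall gamma Gamma : R, q1 * muG < gamma -> gamma < Gamma ->
      ereal_sup [set (relative_error Y Z G muG muH q1 q2 c t x)%:E
                | x in `[gamma * t, Gamma * t]] @[t --> +oo] --> 0%E).
Proof.
case: model => -[Y_G G_ge0 G_mean muG0] [Z_H H_ge0 H_mean muH0] _ c0 _.
have b0 : 0 <= q2 * c by rewrite mulr_ge0// ltW.
have unif eps gamma Gamma : 0 < eps -> q1 * muG < gamma ->
    exists t0, 0 < t0 /\ forall t x, t0 <= t -> gamma * t <= x ->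
    x <= Gamma * t \/ independent_sequences Y Z ->
    relative_error Y Z G muG muH q1 q2 c t x <= eps.
  move=> e0 qg; have g0 : 0 < gamma by apply: lt_trans qg; rewrite mulr_gt0.
  exact: (relative_error_le Y_G G_ge0 G_mean G_C Y_ENOD Z_H H_ge0 H_mean Z_ENOD
            H_oG muG0 muH0 q1_gt0 b0 loading Gamma e0 g0).
split=> [indep gamma qg|_ gamma Gamma qg gG].
  apply: ereal_sup_cvg0 => [t x|t t0|eps e0]; first exact: normr_ge0.
    by exists (gamma * t) => /=.
  have [t0 [t00 Ht]] := unif eps gamma 0 e0 qg.
  exists t0; split=> // t x tt gx; apply: Ht => //; right.
  by move=> A B; exact: case1_setI indep.
apply: ereal_sup_cvg0 => [t x|t t0|eps e0]; first exact: normr_ge0.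
  by exists (gamma * t); rewrite /= in_itv/= lexx/= ler_pM2r// ltW.
have [t0 [t00 Ht]] := unif eps gamma Gamma e0 qg.
exists t0; split=> // t x tt; rewrite /= in_itv/= => /andP[gx xG].
by apply: Ht => //; left.
Qed.
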